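(* Let $p$ be a prime. If $M$ and $N$ are compact connected manifolds that are $\mathbb{Z}_p$-homology cobordant, then for each $n$ $$\pi_1(M)/\pi_1(M)^{(n)}\cong \pi_1(N)/\pi_1(N)^{(n)}.$$
   Context: $\mathbb{Z}_p$ denotes the integers modulo $p$. For a group $G$, the derived $p$-series $\{G^{(n)}\}_{n\ge 0}$ is defined by $G^{(0)}=G$ and $G^{(n+1)}=[G^{(n)},G^{(n)}](G^{(n)})^p$, i.e. the subgroup generated by commutators and $p$-th powers of elements of $G^{(n)}$ (the prime $p$ is suppressed from the notation). $M$ and $N$ are $\mathbb{Z}_p$-homology cobordant if there is a compact cobordism $C$ between them (a compact manifold of one dimension higher with $M$ and $N$ disjointly contained in $\partial C$ as its two ends) such that both inclusions $M\to C$ and $N\to C$ induce isomorphisms on $H_*(-;\mathbb{Z}_p)$. *)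

(* Defs.v *)
From HB Require Import structures.
From mathcomp Require Import all_boot all_order all_algebra.
From mathcomp Require Import all_classical all_reals all_analysis.
From mathcomp Require Import homotopy lra.
From mathcomp.multinomials Require Import freeg.

Set Implicit Arguments.
Unset Strict Implicit.
Unset Printing Implicit Defensive.

Import Order.TTheory GRing.Theory Num.Theory numFieldNormedType.Exports.
Local Open Scope classical_set_scope.
Local Open Scope ring_scope.

Section Subgroups.
Variable G : groupType.
Local Open Scope group_scope.

Definition is_subgroup (H : set G) : Prop :=
  H 1 /\ forall x y, H x -> H y -> H (x / y).

Definition generated (S : set G) : set G := smallest is_subgroup S.

Lemma generated_subgroup S : is_subgroup (generated S).
Proof.
split=> [H [[H1 _] _] //|x y Sx Sy H sH].
by apply: sH.1.2; [apply: Sx | apply: Sy].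
Qed.

Lemma subgroupV H x : is_subgroup H -> H x -> H x^-1.
Proof. by move=> [H1 HV] Hx; rewrite -div1g; apply: HV. Qed.

Lemma subgroupM H x y : is_subgroup H -> H x -> H y -> H (x * y).
Proof.
by move=> sH Hx Hy; rewrite -[y]invgK; apply: sH.2 => //; apply: subgroupV.
Qed.

Record normal_subgroup := NormalSubgroup {
  nset :> set G;
  normal_is_subgroup : is_subgroup nset;
  normal_conj : forall x y, nset x -> nset (x ^ y)
}.

Lemma generated_normal (S : set G) :
  (forall x y, S x -> S (x ^ y)) ->
  forall x y, generated S x -> generated S (x ^ y).
Proof.
move=> nS x y Sx H [sH sSH].
apply: (Sx [set z | H (z ^ y)]); split=> [|z /(nS _ y)]; last exact: sSH.
split=> [|a b Ha Hb] /=; first by rewrite conj1g; exact: sH.1.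
by rewrite conjMg conjVg; apply: sH.2.
Qed.

End Subgroups.

Section QuotientGroup.
Variables (G : groupType) (N : normal_subgroup G).
Local Open Scope group_scope.
Local Open Scope quotient_scope.

Definition coset_rel (x y : G) : bool := `[< nset N (x^-1 * y) >].

Lemma coset_rel_equiv : equiv_class_of coset_rel.
Proof.
have sN := normal_is_subgroup N.
split=> [x|x y|y x z].
- by apply/asboolP; rewrite mulVg; exact: sN.1.
- by apply/idP/idP => /asboolP /(subgroupV sN) h; apply/asboolP;
    rewrite invgM invgK in h.
- move=> /asboolP h1 /asboolP h2; apply/asboolP.
  by have := subgroupM sN h1 h2; rewrite mulgA mulgK.
Qed.

Canonical coset_equiv := EquivRelPack coset_rel_equiv.
Canonical coset_encModRel := defaultEncModRel coset_rel.

Definition quotient_group := {eq_quot coset_rel}.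
HB.instance Definition _ := Choice.on quotient_group.
HB.instance Definition _ : EqQuotient G coset_rel quotient_group :=
  EqQuotient.on quotient_group.

Definition qone : quotient_group := lift_cst quotient_group 1.
Definition qmul := lift_op2 quotient_group *%g.
Definition qinv := lift_op1 quotient_group (fun x : G => x^-1).

Lemma coset_eqP (x y : G) :
  reflect (nset N (x^-1 * y)) (x == y %[mod quotient_group]).
Proof. by rewrite eqmodE; apply: asboolP. Qed.

Canonical pi_qone := PiConst qone.

Lemma pi_qmul : {morph \pi_quotient_group : x y / x * y >-> qmul x y}.
Proof.
have sN := normal_is_subgroup N.
move=> x y; unlock qmul; apply/eqP/coset_eqP.
set x' := repr _; set y' := repr _.
have Nx : nset N (x^-1 * x') by apply/coset_eqP; rewrite reprK.
have Ny : nset N (y^-1 * y') by apply/coset_eqP; rewrite reprK.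
have := subgroupM sN (normal_conj y Nx) Ny.
by rewrite conjgE invgM !mulgA mulgK.
Qed.
Canonical pi_qmul_morph := PiMorph2 pi_qmul.

Lemma pi_qinv : {morph \pi_quotient_group : x / x^-1 >-> qinv x}.
Proof.
have sN := normal_is_subgroup N.
move=> x; unlock qinv; apply/eqP/coset_eqP; set x' := repr _.
have Nx : nset N (x^-1 * x') by apply/coset_eqP; rewrite reprK.
rewrite invgK; have := normal_conj x^-1 (subgroupV sN Nx).
by rewrite conjgE invgM !invgK !mulgA mulgK.
Qed.
Canonical pi_qinv_morph := PiMorph1 pi_qinv.

Lemma qmulA : associative qmul.
Proof. by move=> x y z; rewrite -[x]reprK -[y]reprK -[z]reprK !piE mulgA. Qed.
Lemma qmul1 : right_id qone qmul.
Proof. by move=> x; rewrite -[x]reprK !piE mulg1. Qed.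
Lemma q1mul : left_id qone qmul.
Proof. by move=> x; rewrite -[x]reprK !piE mul1g. Qed.
Lemma qmulV : right_inverse qone qinv qmul.
Proof. by move=> x; rewrite -[x]reprK !piE mulgV. Qed.
Lemma qVmul : left_inverse qone qinv qmul.
Proof. by move=> x; rewrite -[x]reprK !piE mulVg. Qed.

HB.instance Definition _ :=
  isGroup.Build quotient_group qmulA q1mul qmul1 qVmul qmulV.

End QuotientGroup.

Definition isomorphic_groups (G H : groupType) : Prop :=
  exists f : {multiplicative G -> H}, bijective f.

Section DerivedPSeries.
Variables (p : nat) (G : groupType).
Local Open Scope group_scope.

Fixpoint derived_pseries_set (n : nat) : set G :=
  if n is n'.+1 then
    let D := derived_pseries_set n' in
    generated ([set [~ x, y] | x in D & y in D] `|` [set x ^+ p | x in D])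
  else setT.

Lemma derived_pseries_subgroup n : is_subgroup (derived_pseries_set n).
Proof. by case: n => [|n] //; apply: generated_subgroup. Qed.

Lemma derived_pseries_conj n x y :
  derived_pseries_set n x -> derived_pseries_set n (x ^ y).
Proof.
elim: n x y => [//|n IH] x y /=; apply: generated_normal => {}x {}y.
case=> [[a Da] [b Db <-]|[a Da <-]]; [left|right] => /=.
  by exists (a ^ y); [apply: IH|exists (b ^ y); [apply: IH|rewrite conjRg]].
by exists (a ^ y); [apply: IH|rewrite conjXg].
Qed.

Definition derived_pseries (n : nat) : normal_subgroup G :=
  NormalSubgroup (derived_pseries_subgroup n) (@derived_pseries_conj n).

End DerivedPSeries.

Section UnitInterval.
Variable R : realType.

Definition unit_interval : Type := set_type (`[0 : R, 1]%classic).
HB.instance Definition _ := Topological.on unit_interval.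

Lemma clamp_subproof (x : R) :
  Num.max 0 (Num.min 1 x) \in (`[0 : R, 1]%classic : set R).
Proof.
apply/mem_set; rewrite /= in_itv /= le_max lexx /=.
by rewrite ge_max ler01 ge_min lexx.
Qed.

(** The nearest point of the unit interval, used to define paths by formulas
    in a real parameter. *)
Definition clamp (x : R) : unit_interval :=
  exist (fun y => y \in _) _ (clamp_subproof x).

Definition ival (t : unit_interval) : R := set_val t.

Lemma ival_itv (t : unit_interval) : 0 <= ival t <= 1.
Proof. by have := set_valP t; rewrite /= in_itv. Qed.

Lemma ival_inj : injective ival.
Proof. exact: val_inj. Qed.

Lemma clampK (x : R) : 0 <= x <= 1 -> ival (clamp x) = x.
Proof. by move=> /andP[x0 x1]; rewrite /ival set_valE /= min_r // max_r. Qed.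

Lemma ivalK : cancel ival clamp.
Proof. by move=> t; apply: ival_inj; rewrite clampK // ival_itv. Qed.

Lemma ival_continuous : continuous ival.
Proof. exact: initial_continuous. Qed.

Lemma clamp_continuous : continuous clamp.
Proof.
apply: (@continuous_comp_initial _ _ _ set_val) => x.
apply: (@continuous_max R R (cst 0) (Num.min 1)); first exact: cvg_cst.
apply: (@continuous_min R R (cst 1) id) => //; exact: cvg_cst.
Qed.

Lemma clamp0_neq1 : clamp 0 != clamp 1.
Proof.
apply/eqP => /(congr1 ival); rewrite !clampK ?lexx ?ler01 //.
by move/eqP; rewrite eq_sym oner_eq0.
Qed.

HB.instance Definition _ :=
  isBiPointed.Build unit_interval clamp0_neq1.

Lemma ival0 : ival zero = 0. Proof. by rewrite clampK ?lexx ?ler01. Qed.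
Lemma ival1 : ival one = 1. Proof. by rewrite clampK ?lexx ?ler01. Qed.

End UnitInterval.

Section ContinuousFunctions.
Variables (R : realType) (T U V : topologicalType).

Lemma cst_cts (k : U) : continuous (fun _ : T => k).
Proof. by move=> t; exact: cvg_cst. Qed.

Lemma add_cts (u v : T -> R) :
  continuous u -> continuous v -> continuous (fun t => u t + v t).
Proof. by move=> cu cv t; apply: cvgD; [exact: cu | exact: cv]. Qed.

Lemma sub_cts (u v : T -> R) :
  continuous u -> continuous v -> continuous (fun t => u t - v t).
Proof. by move=> cu cv t; apply: cvgB; [exact: cu | exact: cv]. Qed.

Lemma mul_cts (u v : T -> R) :
  continuous u -> continuous v -> continuous (fun t => u t * v t).
Proof. by move=> cu cv t; apply: cvgM; [exact: cu | exact: cv]. Qed.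

Lemma pair_cts (a : T -> U) (b : T -> V) :
  continuous a -> continuous b -> continuous (fun t => (a t, b t)).
Proof. by move=> ca cb t; apply: cvg_pair; [exact: ca | exact: cb]. Qed.

Lemma comp_cts (a : T -> U) (b : U -> V) :
  continuous a -> continuous b -> continuous (fun t => b (a t)).
Proof. by move=> ca cb t; apply: continuous_comp; [exact: ca | exact: cb]. Qed.

Lemma fst_cts : continuous (@fst T U).
Proof. by move=> ?; exact: cvg_fst. Qed.

Lemma snd_cts : continuous (@snd T U).
Proof. by move=> ?; exact: cvg_snd. Qed.

Lemma continuous_piecewise (u : T -> R) (c : R) (a b : T -> U) :
  continuous u -> continuous a -> continuous b ->
  (forall t, u t = c -> a t = b t) ->
  continuous (fun t => if u t <= c then a t else b t).
Proof.
move=> cu ca cb ab; apply/continuous_closedP => W cW.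
have cl (v : T -> U) (D : set R) : continuous v -> closed D ->
    closed (v @^-1` W `&` u @^-1` D).
  by move=> cv cD; apply: closedI; [move: W cW|move: D cD];
    exact/continuous_closedP.
have := closedU (cl _ _ ca (@closed_le _ c)) (cl _ _ cb (@closed_ge _ c)).
congr closed; apply/seteqP; split=> t /=.
  case=> -[Wt ut]; first by rewrite ut.
  by case: leP => // tu; rewrite ab //; apply/eqP; rewrite eq_le tu ut.
by case: leP => ut Wt; [left|right; split=> //; exact: ltW].
Qed.

End ContinuousFunctions.

Section FundamentalGroup.
Variables (R : realType) (X : topologicalType) (x : X).
Local Notation I := (unit_interval R).
Local Notation loop := ({path I from x to x in X}).
Implicit Types f g h : loop.

(** Homotopy relative to the endpoints; the second coordinate is the homotopy
    parameter. *)
Definition loop_homotopic f g : Prop :=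
  exists H : continuousType (I * I)%type X,
    [/\ forall s, H (s, zero) = f s, forall s, H (s, one) = g s,
        forall t, H (zero, t) = x & forall t, H (one, t) = x].

Lemma loop_homotopicI (H : I * I -> X) f g : continuous H ->
  (forall s, H (s, zero) = f s) -> (forall s, H (s, one) = g s) ->
  (forall t, H (zero, t) = x) -> (forall t, H (one, t) = x) ->
  loop_homotopic f g.
Proof. by move=> cH *; exists (mkcts cH). Qed.

Lemma path_clamp_continuous (T : topologicalType) f (u : T -> R) :
  continuous u -> continuous (fun t => f (clamp (u t))).
Proof.
move=> cu t; apply: (@continuous_comp _ _ _ u (f \o @clamp R)); first exact: cu.
apply: continuous_comp; [exact: clamp_continuous | exact: cts_fun].
Qed.

Lemma loop_clamp_le0 f (r : R) : r <= 0 -> f (clamp r) = x.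
Proof.
move=> r0; rewrite -[RHS](@path_zero _ _ _ _ f); congr (f _).
apply: ival_inj.
by rewrite ival0 /ival set_valE /= max_l // ge_min r0 orbT.
Qed.

Lemma loop_clamp_ge1 f (r : R) : 1 <= r -> f (clamp r) = x.
Proof.
move=> r1; rewrite -[RHS](@path_one _ _ _ _ f); congr (f _).
apply: ival_inj.
by rewrite ival1 /ival set_valE /= min_l // max_r.
Qed.

Definition loop_cat_fun f g (s : I) : X :=
  if ival s <= 2^-1 then f (clamp (2 * ival s)) else g (clamp (2 * ival s - 1)).

Lemma loop_cat_fun_continuous f g : continuous (loop_cat_fun f g).
Proof.
have c2 : continuous (fun s : I => 2 * ival s).
  by apply: mul_cts; [exact: cst_cts | exact: ival_continuous].
apply: continuous_piecewise.
- exact: ival_continuous.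
- exact: path_clamp_continuous.
- apply: path_clamp_continuous.
  by apply: sub_cts; [exact: c2 | exact: cst_cts].
- move=> s ->; rewrite mulfV ?pnatr_eq0 // subrr.
  by rewrite loop_clamp_ge1 // loop_clamp_le0.
Qed.

Lemma loop_cat_fun_zero f g : loop_cat_fun f g zero = x.
Proof.
by rewrite /loop_cat_fun ival0 invr_ge0 ler0n mulr0 loop_clamp_le0.
Qed.

Lemma loop_cat_fun_one f g : loop_cat_fun f g one = x.
Proof.
rewrite /loop_cat_fun ival1 ifF; last by apply/negbTE; rewrite -ltNge; lra.
by rewrite loop_clamp_ge1 //; lra.
Qed.

Definition loop_cat f g : loop :=
  mk_path (@loop_cat_fun_continuous f g)
    (loop_cat_fun_zero f g) (loop_cat_fun_one f g).

Definition loop_inv_fun f (s : I) : X := f (clamp (1 - ival s)).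

Lemma loop_inv_fun_continuous f : continuous (loop_inv_fun f).
Proof.
apply: path_clamp_continuous.
by apply: sub_cts; [exact: cst_cts | exact: ival_continuous].
Qed.

Lemma loop_inv_fun_zero f : loop_inv_fun f zero = x.
Proof. by rewrite /loop_inv_fun ival0 loop_clamp_ge1 ?subr0. Qed.

Lemma loop_inv_fun_one f : loop_inv_fun f one = x.
Proof. by rewrite /loop_inv_fun ival1 loop_clamp_le0 ?subrr. Qed.

Definition loop_inv f : loop :=
  mk_path (@loop_inv_fun_continuous f) (loop_inv_fun_zero f)
    (loop_inv_fun_one f).

Definition loop_cst : loop := cst x.

Definition itv_rev (t : I) : I := clamp (1 - ival t).

Lemma itv_rev_continuous : continuous itv_rev.
Proof.
apply: (@comp_cts _ _ _ (fun t : I => 1 - ival t) (@clamp R)).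
  by apply: sub_cts; [exact: cst_cts | exact: ival_continuous].
exact: clamp_continuous.
Qed.

Lemma itv_rev0 : itv_rev zero = one.
Proof. by rewrite /itv_rev ival0 subr0. Qed.
Lemma itv_rev1 : itv_rev one = zero.
Proof. by rewrite /itv_rev ival1 subrr. Qed.

Lemma loop_homotopic_refl f : loop_homotopic f f.
Proof.
apply: (@loop_homotopicI (fun st => f st.1)) => //=.
- by apply: (@comp_cts _ _ _ fst f); [exact: fst_cts | exact: cts_fun].
- by move=> _; exact: path_zero.
- by move=> _; exact: path_one.
Qed.

Lemma loop_homotopic_sym f g : loop_homotopic f g -> loop_homotopic g f.
Proof.
move=> [H [H0 H1 Hz Ho]].
apply: (@loop_homotopicI (fun st => H (st.1, itv_rev st.2))) => /=.
- apply: (@comp_cts _ _ _ (fun st : I * I => (st.1, itv_rev st.2)) H).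
    apply: pair_cts; first exact: fst_cts.
    by apply: comp_cts; [exact: snd_cts | exact: itv_rev_continuous].
  exact: cts_fun.
- by move=> s; rewrite itv_rev0.
- by move=> s; rewrite itv_rev1.
- by [].
- by [].
Qed.

Lemma loop_homotopic_trans f g h :
  loop_homotopic f g -> loop_homotopic g h -> loop_homotopic f h.
Proof.
move=> [H [H0 H1 Hz Ho]] [K [K0 K1 Kz Ko]].
pose c (r : R) := clamp r : I.
have cu (k : R) : continuous (fun st : I * I => c (2 * ival st.2 - k)).
  apply: (@comp_cts _ _ _ (fun st : I * I => 2 * ival st.2 - k) c).
    apply: sub_cts; last exact: cst_cts.
    apply: mul_cts; first exact: cst_cts.
    exact: (comp_cts (@snd_cts I I) (@ival_continuous R)).
  exact: clamp_continuous.
have cut (k : R) : continuous (fun st : I * I => (st.1, c (2 * ival st.2 - k))).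
  by apply: pair_cts; [exact: fst_cts | exact: cu].
apply: (@loop_homotopicI (fun st => if ival st.2 <= 2^-1
    then H (st.1, c (2 * ival st.2 - 0)) else K (st.1, c (2 * ival st.2 - 1)))).
- apply: (@continuous_piecewise _ _ _ (fun st : I * I => ival st.2)).
  + exact: (comp_cts (@snd_cts I I) (@ival_continuous R)).
  + by apply: (comp_cts (cut 0)); exact: cts_fun.
  + by apply: (comp_cts (cut 1)); exact: cts_fun.
  + move=> [s t] /= ->; rewrite mulfV ?pnatr_eq0 // subrr subr0.
    by rewrite -[c 1]/one -[c 0]/zero H1 K0.
- by move=> s /=; rewrite ival0 invr_ge0 ler0n mulr0 subrr -[c 0]/zero H0.
- move=> s /=; rewrite ival1 ifF; last by apply/negbTE; rewrite -ltNge; lra.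
  by rewrite (_ : 2 * 1 - 1 = 1) -1?[c 1]/one ?K1 //; lra.
- by move=> t /=; rewrite Hz Kz if_same.
- by move=> t /=; rewrite Ho Ko if_same.
Qed.

Lemma reparam_homotopic (h f g : loop) (u v : I -> R) :
  continuous u -> continuous v ->
  (forall s, f s = h (clamp (u s))) -> (forall s, g s = h (clamp (v s))) ->
  u zero = v zero -> u one = v one -> loop_homotopic f g.
Proof.
move=> cu cv fu gv uv0 uv1.
apply: (@loop_homotopicI (fun st => h (clamp
   ((1 - ival st.2) * u st.1 + ival st.2 * v st.1)))) => /=.
- apply: path_clamp_continuous.
  have ct : continuous (fun st : I * I => ival st.2).
    exact: (comp_cts (@snd_cts I I) (@ival_continuous R)).
  apply: add_cts; apply: mul_cts.
  + by apply: sub_cts; [exact: cst_cts | exact: ct].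
  + exact: (comp_cts (@fst_cts I I) cu).
  + exact: ct.
  + exact: (comp_cts (@fst_cts I I) cv).
- by move=> s; rewrite ival0 subr0 mul1r mul0r addr0 fu.
- by move=> s; rewrite ival1 subrr mul1r mul0r add0r gv.
- move=> t; rewrite uv0 -mulrDl subrK mul1r -gv; exact: path_zero.
- move=> t; rewrite uv1 -mulrDl subrK mul1r -gv; exact: path_one.
Qed.

Lemma loop_cat_homotopic f f' g g' : loop_homotopic f f' ->
  loop_homotopic g g' -> loop_homotopic (loop_cat f g) (loop_cat f' g').
Proof.
move=> [H [H0 H1 Hz Ho]] [K [K0 K1 Kz Ko]].
pose c (r : R) := clamp r : I.
have Hge1 t (r : R) : 1 <= r -> H (c r, t) = x.
  move=> r1; rewrite (_ : c r = one) ?Ho //; apply: ival_inj.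
  by rewrite ival1 /ival set_valE /= min_l // max_r.
have Kle0 t (r : R) : r <= 0 -> K (c r, t) = x.
  move=> r0; rewrite (_ : c r = zero) ?Kz //; apply: ival_inj.
  by rewrite ival0 /ival set_valE /= max_l // ge_min r0 orbT.
have cu (k : R) :
    continuous (fun st : I * I => (c (2 * ival st.1 - k), st.2)).
  apply: pair_cts; last exact: snd_cts.
  apply: (@comp_cts _ _ _ (fun st : I * I => 2 * ival st.1 - k) c).
    apply: sub_cts; last exact: cst_cts.
    apply: mul_cts; first exact: cst_cts.
    exact: (comp_cts (@fst_cts I I) (@ival_continuous R)).
  exact: clamp_continuous.
apply: (@loop_homotopicI (fun st => if ival st.1 <= 2^-1
    then H (c (2 * ival st.1 - 0), st.2) else K (c (2 * ival st.1 - 1), st.2))).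
- apply: (@continuous_piecewise _ _ _ (fun st : I * I => ival st.1)).
  + exact: (comp_cts (@fst_cts I I) (@ival_continuous R)).
  + by apply: (comp_cts (cu 0)); exact: cts_fun.
  + by apply: (comp_cts (cu 1)); exact: cts_fun.
  + by move=> [s t] /= ->; rewrite mulfV ?pnatr_eq0 // Hge1 ?subr0 // Kle0 ?subrr.
- by move=> s; rewrite /= /loop_cat_fun subr0 H0 K0.
- by move=> s; rewrite /= /loop_cat_fun subr0 H1 K1.
- by move=> t /=; rewrite ival0 invr_ge0 ler0n mulr0 subrr -[c 0]/zero Hz.
- move=> t /=; rewrite ival1 ifF; last by apply/negbTE; rewrite -ltNge; lra.
  by rewrite (_ : 2 * 1 - 1 = 1) -1?[c 1]/one ?Ko //; lra.
Qed.

Lemma loop_inv_homotopic f g :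
  loop_homotopic f g -> loop_homotopic (loop_inv f) (loop_inv g).
Proof.
move=> [H [H0 H1 Hz Ho]].
apply: (@loop_homotopicI (fun st => H (itv_rev st.1, st.2))) => /=.
- apply: (@comp_cts _ _ _ (fun st : I * I => (itv_rev st.1, st.2)) H).
    apply: pair_cts; last exact: snd_cts.
    by apply: comp_cts; [exact: fst_cts | exact: itv_rev_continuous].
  exact: cts_fun.
- by move=> s; rewrite H0.
- by move=> s; rewrite H1.
- by move=> t; rewrite itv_rev0.
- by move=> t; rewrite itv_rev1.
Qed.

Lemma ival_half_cts : continuous (fun s : I => 2 * ival s).
Proof. by apply: mul_cts; [exact: cst_cts | exact: ival_continuous]. Qed.

Lemma half_ge0 : (0 : R) <= 2^-1. Proof. lra. Qed.
Lemma half_ge1F : ((1 : R) <= 2^-1) = false.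
Proof. by apply/negbTE; rewrite -ltNge; lra. Qed.

Lemma loop_catE f g (s : I) : loop_cat f g s =
  if ival s <= 2^-1 then f (clamp (2 * ival s)) else g (clamp (2 * ival s - 1)).
Proof. by []. Qed.

Lemma loop_invE f (s : I) : loop_inv f s = f (clamp (1 - ival s)).
Proof. by []. Qed.

Lemma loop_catf1 f : loop_homotopic (loop_cat f loop_cst) f.
Proof.
apply: (@reparam_homotopic f _ _
  (fun s => if ival s <= 2^-1 then 2 * ival s else 1) (@ival R)).
- apply: continuous_piecewise.
  + exact: ival_continuous.
  + exact: ival_half_cts.
  + exact: cst_cts.
  + by move=> t ->; lra.
- exact: ival_continuous.
- by move=> s; rewrite loop_catE; case: leP => // s2; rewrite [RHS]loop_clamp_ge1.
- by move=> s; rewrite ivalK.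
- by rewrite ival0 half_ge0 mulr0.
- by rewrite ival1 half_ge1F.
Qed.

Lemma loop_cat1f f : loop_homotopic (loop_cat loop_cst f) f.
Proof.
apply: (@reparam_homotopic f _ _
  (fun s => if ival s <= 2^-1 then 0 else 2 * ival s - 1) (@ival R)).
- apply: continuous_piecewise.
  + exact: ival_continuous.
  + exact: cst_cts.
  + by apply: sub_cts; [exact: ival_half_cts | exact: cst_cts].
  + by move=> t ->; lra.
- exact: ival_continuous.
- by move=> s; rewrite loop_catE; case: leP => // s2; rewrite [RHS]loop_clamp_le0.
- by move=> s; rewrite ivalK.
- by rewrite ival0 half_ge0.
- by rewrite ival1 half_ge1F; lra.
Qed.

Lemma loop_catfV f : loop_homotopic (loop_cat f (loop_inv f)) loop_cst.
Proof.
apply: (@reparam_homotopic f _ _ (fun s => if ival s <= 2^-1 then 2 * ival s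
  else 1 - (2 * ival s - 1)) (fun=> 0)).
- apply: continuous_piecewise.
  + exact: ival_continuous.
  + exact: ival_half_cts.
  + apply: sub_cts; first exact: cst_cts.
    by apply: sub_cts; [exact: ival_half_cts | exact: cst_cts].
  + by move=> t ->; lra.
- exact: cst_cts.
- move=> s; rewrite loop_catE loop_invE; case: leP => // s2.
  by rewrite clampK //; have /andP[s0 s1] := ival_itv s; apply/andP; split; lra.
- by move=> s; rewrite loop_clamp_le0.
- by rewrite ival0 half_ge0 mulr0.
- by rewrite ival1 half_ge1F; lra.
Qed.

Lemma loop_catVf f : loop_homotopic (loop_cat (loop_inv f) f) loop_cst.
Proof.
apply: (@reparam_homotopic f _ _ (fun s => if ival s <= 2^-1
  then 1 - 2 * ival s else 2 * ival s - 1) (fun=> 1)).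
- apply: continuous_piecewise.
  + exact: ival_continuous.
  + by apply: sub_cts; [exact: cst_cts | exact: ival_half_cts].
  + by apply: sub_cts; [exact: ival_half_cts | exact: cst_cts].
  + by move=> t ->; lra.
- exact: cst_cts.
- move=> s; rewrite loop_catE loop_invE; case: leP => // s2.
  by rewrite clampK //; have /andP[s0 s1] := ival_itv s; apply/andP; split; lra.
- by move=> s; rewrite loop_clamp_ge1.
- by rewrite ival0 half_ge0 mulr0 subr0.
- by rewrite ival1 half_ge1F; lra.
Qed.

Lemma loop_catA f g h :
  loop_homotopic (loop_cat f (loop_cat g h)) (loop_cat (loop_cat f g) h).
Proof.
apply: (@reparam_homotopic (loop_cat f (loop_cat g h)) _ _ (@ival R)
  (fun s => if ival s <= 4^-1 then 2 * ival s else
            if ival s <= 2^-1 then ival s + 4^-1 else 2^-1 * (ival s + 1))).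
- exact: ival_continuous.
- apply: continuous_piecewise.
  + exact: ival_continuous.
  + exact: ival_half_cts.
  + apply: continuous_piecewise.
    * exact: ival_continuous.
    * by apply: add_cts; [exact: ival_continuous | exact: cst_cts].
    * apply: mul_cts; first exact: cst_cts.
      by apply: add_cts; [exact: ival_continuous | exact: cst_cts].
    * by move=> t ->; lra.
  + move=> t ->; rewrite ifT; lra.
- by move=> s; rewrite ivalK.
- move=> s; have /andP[s0 s1] := ival_itv s.
  have E (r : R) : 0 <= r -> r <= 1 -> ival (clamp r) = r.
    by move=> r0 r1; rewrite clampK ?r0.
  have [s4|s4] := leP (ival s) 4^-1.
    have s2 : ival s <= 2^-1 by lra.
    rewrite [LHS]loop_catE s2 [LHS]loop_catE [RHS]loop_catE.
    by rewrite !E ?ifT //; lra.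
  have [s2|s2] := leP (ival s) 2^-1.
    rewrite [LHS]loop_catE s2 [LHS]loop_catE E; [|lra..].
    rewrite ifF; last by apply/negbTE; rewrite -ltNge; lra.
    rewrite [RHS]loop_catE E; [|lra..].
    rewrite ifF; last by apply/negbTE; rewrite -ltNge; lra.
    rewrite [RHS]loop_catE E; [|lra..].
    by rewrite ifT; [congr (g (clamp _))|]; lra.
  rewrite [LHS]loop_catE ifF; last by apply/negbTE; rewrite -ltNge.
  rewrite [RHS]loop_catE E; [|lra..].
  rewrite ifF; last by apply/negbTE; rewrite -ltNge; lra.
  rewrite [RHS]loop_catE E; [|lra..].
  rewrite ifF; last by apply/negbTE; rewrite -ltNge; lra.
  by congr (h (clamp _)); lra.
- rewrite ival0 ifT; lra.
- rewrite ival1 half_ge1F ifF; first lra.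
  by apply/negbTE; rewrite -ltNge; lra.
Qed.

Definition loop_rel f g : bool := `[< loop_homotopic f g >].

Lemma loop_rel_equiv : equiv_class_of loop_rel.
Proof.
split=> [f|f g|g f h].
- by apply/asboolP; exact: loop_homotopic_refl.
- by apply/asboolP/asboolP; exact: loop_homotopic_sym.
- by move=> /asboolP fg /asboolP gh; apply/asboolP;
    exact: loop_homotopic_trans fg gh.
Qed.

Canonical loop_equiv := EquivRelPack loop_rel_equiv.
Canonical loop_encModRel := defaultEncModRel loop_rel.

Local Open Scope quotient_scope.

Definition pi1 := {eq_quot loop_rel}.
HB.instance Definition _ := Choice.on pi1.
HB.instance Definition _ : EqQuotient loop loop_rel pi1 := EqQuotient.on pi1.

Definition pi1_one : pi1 := lift_cst pi1 loop_cst.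
Definition pi1_mul := lift_op2 pi1 loop_cat.
Definition pi1_inv := lift_op1 pi1 loop_inv.

Lemma pi1_eqP f g : reflect (loop_homotopic f g) (f == g %[mod pi1]).
Proof. by rewrite eqmodE; apply: asboolP. Qed.

Canonical pi_pi1_one := PiConst pi1_one.

Lemma pi_pi1_mul : {morph \pi_pi1 : f g / loop_cat f g >-> pi1_mul f g}.
Proof.
move=> f g; unlock pi1_mul; apply/eqP/pi1_eqP.
by apply: loop_cat_homotopic; apply/pi1_eqP; rewrite reprK.
Qed.
Canonical pi_pi1_mul_morph := PiMorph2 pi_pi1_mul.

Lemma pi_pi1_inv : {morph \pi_pi1 : f / loop_inv f >-> pi1_inv f}.
Proof.
move=> f; unlock pi1_inv; apply/eqP/pi1_eqP.
by apply: loop_inv_homotopic; apply/pi1_eqP; rewrite reprK.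
Qed.
Canonical pi_pi1_inv_morph := PiMorph1 pi_pi1_inv.

Lemma pi1_mulA : associative pi1_mul.
Proof.
move=> a b c; rewrite -[a]reprK -[b]reprK -[c]reprK !piE.
by apply/eqP/pi1_eqP; exact: loop_catA.
Qed.

Lemma pi1_mul1l : left_id pi1_one pi1_mul.
Proof.
by move=> a; rewrite -[a]reprK !piE; apply/eqP/pi1_eqP; exact: loop_cat1f.
Qed.

Lemma pi1_mul1r : right_id pi1_one pi1_mul.
Proof.
by move=> a; rewrite -[a]reprK !piE; apply/eqP/pi1_eqP; exact: loop_catf1.
Qed.

Lemma pi1_mulVl : left_inverse pi1_one pi1_inv pi1_mul.
Proof.
by move=> a; rewrite -[a]reprK !piE; apply/eqP/pi1_eqP; exact: loop_catVf.
Qed.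

Lemma pi1_mulVr : right_inverse pi1_one pi1_inv pi1_mul.
Proof.
by move=> a; rewrite -[a]reprK !piE; apply/eqP/pi1_eqP; exact: loop_catfV.
Qed.

HB.instance Definition _ :=
  isGroup.Build pi1 pi1_mulA pi1_mul1l pi1_mul1r pi1_mulVl pi1_mulVr.

End FundamentalGroup.

Section FreeModule.
Variables (F : nzRingType) (K : choiceType) (M : lmodType F) (f : K -> M).

Lemma fglift_sum (I : Type) (r : seq I) (c : I -> {freeg K / F}) :
  fglift f (\sum_(i <- r) c i) = \sum_(i <- r) fglift f (c i).
Proof.
pose g : {additive {freeg K / F} -> M} :=
  HB.pack (fglift f) (GRing.isZmodMorphism.Build _ _ _ (lift_is_additive f)).
exact: (raddf_sum g).
Qed.

Lemma scale_freegU (a b : F) (x : K) : a *: << b *g x >> = << a * b *g x >>.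
Proof. by apply/eqP/freeg_eqP => y; rewrite coeffZ !coeffU mulrA. Qed.

Lemma fglift_scale (a : F) (c : {freeg K / F}) :
  fglift f (a *: c) = a *: fglift f c.
Proof.
rewrite -[c]freeg_sumE scaler_sumr !fglift_sum scaler_sumr.
by apply: eq_bigr => x _; rewrite scale_freegU !liftU scalerA.
Qed.

End FreeModule.

Section SingularHomology.
Variables (R : realType) (p : nat).
Implicit Types (X Y : topologicalType) (k : nat).

Definition std_simplex k : set 'rV[R]_k.+1 :=
  [set v | (forall j, 0 <= v 0 j) /\ \sum_j v 0 j = 1].
Arguments std_simplex : clear implicits.

Definition face_vec k (i : 'I_k.+2) (v : 'rV[R]_k.+1) : 'rV[R]_k.+2 :=
  \row_j (if unlift i j is Some j' then v 0 j' else 0).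

Lemma face_vec_simplex k (i : 'I_k.+2) (v : std_simplex k) :
  face_vec i (set_val v) \in std_simplex k.+1.
Proof.
have [v0 v1] : std_simplex k (set_val v) by exact: set_valP.
apply/mem_set; split=> [j|].
  by rewrite mxE; case: (unlift i j) => //.
rewrite (bigD1_ord i) //= mxE unlift_none add0r -[RHS]v1.
by apply: eq_bigr => j _; rewrite mxE liftK.
Qed.

Definition face k (i : 'I_k.+2) (v : std_simplex k) : std_simplex k.+1 :=
  exist _ (face_vec i (set_val v)) (face_vec_simplex i v).

Lemma face_vec_continuous k (i : 'I_k.+2) : continuous (@face_vec k i).
Proof.
move=> v A [P Pn sPA]; have Pv (j : 'I_k.+2) :
    nbhs v [set w : 'rV[R]_k.+1 | P 0 j (face_vec i w 0 j)].
  have := Pn 0 j; rewrite mxE.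
  under [in X in _ -> X]eq_set do rewrite mxE.
  case: (unlift i j) => [j'|] Pj; first exact: coord_continuous Pj.
  by apply: (@filterE _ (nbhs v)) => w; exact: nbhs_singleton Pj.
have : \forall w \near v, forall j, P 0 j (face_vec i w 0 j).
  exact: (@filter_forall _ _ _ (nbhs v) (nbhs_filter v) Pv).
apply: filterS => w Pw; apply: sPA => a b.
by rewrite (ord1 a); exact: Pw.
Qed.

Lemma face_continuous k (i : 'I_k.+2) : continuous (@face k i).
Proof.
apply: (@continuous_comp_initial _ _ _ set_val) => v.
apply: (@continuous_comp _ _ _ set_val (@face_vec k i)).
  exact: initial_continuous.
exact: face_vec_continuous.
Qed.

HB.instance Definition _ k (i : 'I_k.+2) :=
  isContinuous.Build _ _ (@face k i) (@face_continuous k i).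

Definition singular_simplex k X : Type := continuousType (std_simplex k) X.
HB.instance Definition _ k X := Choice.on (singular_simplex k X).

(** ['F_p] is the ring of integers modulo [p] only when [p] is prime. *)
Definition chain k X : Type := {freeg (singular_simplex k X) / 'F_p}.
HB.instance Definition _ k X := GRing.Lmodule.on (chain k X).

Definition chain_of k X (s : continuousType (std_simplex k) X) : chain k X :=
  Freeg [:: (1, s : singular_simplex k X)].

Definition boundary k X : chain k.+1 X -> chain k X :=
  fglift (fun s : continuousType (std_simplex k.+1) X =>
    \sum_(i < k.+2) (-1) ^+ i *: chain_of (s \o face i)).

Lemma boundary_is_additive k X : zmod_morphism (@boundary k X).
Proof. exact: lift_is_additive. Qed.

HB.instance Definition _ k X :=
  GRing.isZmodMorphism.Build _ _ (@boundary k X) (@boundary_is_additive k X).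

Definition chain_map k X Y (f : continuousType X Y) : chain k X -> chain k Y :=
  fglift (fun s : continuousType (std_simplex k) X => chain_of (f \o s)).

Lemma chain_map_is_additive k X Y (f : continuousType X Y) :
  zmod_morphism (@chain_map k X Y f).
Proof. exact: lift_is_additive. Qed.

HB.instance Definition _ k X Y (f : continuousType X Y) :=
  GRing.isZmodMorphism.Build _ _ (@chain_map k X Y f)
    (@chain_map_is_additive k X Y f).

Lemma chain_map_boundary k X Y (f : continuousType X Y) (c : chain k.+1 X) :
  chain_map f (boundary c) = boundary (chain_map f c).
Proof.
rewrite -[c]freeg_sumE !raddf_sum; refine (eq_bigr _ _) => s _ /=.
rewrite /boundary /chain_map !liftU !fglift_scale liftU scale1r fglift_sum.
congr (_ *: _); refine (eq_bigr _ _) => i _.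
rewrite fglift_scale /chain_of !liftU !scale1r; congr (_ *: Freeg [:: (_, _)]).
exact/continuousEP.
Qed.

Definition cycle k X : {pred chain k X} :=
  match k return {pred chain k X} with
  | 0 => predT
  | k'.+1 => fun c => boundary c == 0
  end.

Lemma cycle_zmod_closed k X : zmod_closed (@cycle k X).
Proof.
case: k => [//|k]; split=> [|c d /eqP c0 /eqP d0].
  by rewrite unfold_in raddf0.
by rewrite unfold_in raddfB /= c0 d0 subr0.
Qed.

HB.instance Definition _ k X :=
  GRing.isZmodClosed.Build _ (@cycle k X) (@cycle_zmod_closed k X).

Definition cycles k X : Type := {c : chain k X | c \in @cycle k X}.
HB.instance Definition _ k X := SubChoice.on (cycles k X).
HB.instance Definition _ k X :=
  [SubChoice_isSubZmodule of cycles k X by <:].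

Definition bounding k X : {pred cycles k X} :=
  fun z => `[< exists c : chain k.+1 X, boundary c = val z >].

Lemma bounding_zmod_closed k X : zmod_closed (@bounding k X).
Proof.
split=> [|y z /asboolP[c cy] /asboolP[d dz]]; apply/asboolP.
  by exists 0; rewrite !raddf0.
by exists (c - d); rewrite !raddfB /= cy dz.
Qed.

HB.instance Definition _ k X :=
  GRing.isZmodClosed.Build _ (@bounding k X) (@bounding_zmod_closed k X).

Definition homology k X : zmodType := {ideal_quot (@bounding k X)}.

Lemma chain_map_cycle k X Y (f : continuousType X Y) (z : cycles k X) :
  chain_map f (val z) \in @cycle k Y.
Proof.
case: k z => [//|k] [c /= /eqP c0].
by rewrite unfold_in -chain_map_boundary c0 raddf0.
Qed.

Definition cycle_map k X Y (f : continuousType X Y) (z : cycles k X) :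
  cycles k Y := Sub (chain_map f (val z)) (chain_map_cycle f z).

Definition homology_map k X Y (f : continuousType X Y)
    (h : homology k X) : homology k Y :=
  \pi_{ideal_quot (@bounding k Y)}%qT (cycle_map f (repr h)).

Lemma homology_map_pi k X Y (f : continuousType X Y) (z : cycles k X) :
  homology_map f (\pi_{ideal_quot (@bounding k X)}%qT z) =
  \pi_{ideal_quot (@bounding k Y)}%qT (cycle_map f z).
Proof.
apply/eqP; rewrite -Quotient.idealrBE.
have : repr (\pi_{ideal_quot (@bounding k X)}%qT z) - z \in @bounding k X.
  by rewrite Quotient.idealrBE reprK.
move=> /asboolP[c cz]; apply/asboolP; exists (chain_map f c).
by rewrite -chain_map_boundary cz !raddfB.
Qed.

Lemma homology_map_is_additive k X Y (f : continuousType X Y) :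
  zmod_morphism (@homology_map k X Y f).
Proof.
move=> g h; rewrite -[g]reprK -[h]reprK -raddfB !homology_map_pi -raddfB.
by congr (\pi _)%qT; apply: val_inj; rewrite /= !raddfB.
Qed.

HB.instance Definition _ k X Y (f : continuousType X Y) :=
  GRing.isZmodMorphism.Build _ _ (@homology_map k X Y f)
    (@homology_map_is_additive k X Y f).

End SingularHomology.

Section Manifolds.
Variable R : realType.
Implicit Types (m : nat) (X : topologicalType).

(** In positive dimension the first coordinate is nonnegative; for m = 0
    the half-space is a point, with empty boundary. *)
Definition half_space m : set 'rV[R]_m :=
  [set v | forall i : 'I_m, i = 0%N :> nat -> 0 <= v 0 i].
Arguments half_space : clear implicits.

Definition half_space_boundary m : set 'rV[R]_m :=
  [set v | exists2 i : 'I_m, i = 0%N :> nat & v 0 i = 0].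

(** A homeomorphism of the domain onto an open subset of the half-space *)
Record chart m X := Chart {
  chart_dom : set X;
  chart_map : set_type chart_dom -> set_type (half_space m);
  chart_dom_open : open chart_dom;
  chart_continuous : continuous chart_map;
  chart_injective : injective chart_map;
  chart_open : forall A, open A -> open (chart_map @` A)
}.

Definition manifold m X : Prop :=
  [/\ hausdorff_space X, @second_countable X &
      forall x : X, exists c : chart m X, chart_dom c x].

Definition boundary_points m X : set X :=
  [set x | exists (c : chart m X) (u : set_type (chart_dom c)),
     set_val u = x /\ half_space_boundary (set_val (chart_map u))].

End Manifolds.

Definition topological_embedding (X Y : topologicalType) (f : X -> Y) : Prop :=
  [/\ continuous f, injective f &
      forall A : set X, open A -> exists2 B : set Y, open B & f @^-1` B = A].

Section Cobordism.
Variables (R : realType) (m : nat) (M N : topologicalType).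

(** [M] and [N] may themselves have boundary: then the rest of the boundary of
    [C] is nonempty, and it is left unconstrained. *)
Definition cobordism (C : topologicalType) (i : M -> C) (j : N -> C) : Prop :=
  [/\ manifold R m.+1 C /\ compact [set: C],
      topological_embedding i, topological_embedding j,
      range i `|` range j `<=` @boundary_points R m.+1 C &
      range i `&` range j = set0].

Definition homology_cobordant (p : nat) : Prop :=
  exists (C : topologicalType) (i : continuousType M C) (j : continuousType N C),
    [/\ cobordism i j,
        forall k, bijective (@homology_map R p k M C i) &
        forall k, bijective (@homology_map R p k N C j)].

End Cobordism.

(* Main.v *)
(** Stallings' argument, run on nonabelian singular cocycles. Up to a gauge
    transformation, a homomorphism from [pi_1(X)] to a group [K] is a function
    [c] on singular 1-simplices with [c(d2 s) c(d0 s) = c(d1 s)] for every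
    singular 2-simplex [s]. If [f : X -> Y] is bijective on [H_1] and
    surjective on [H_2] with coefficients in [F_p], it is bijective on
    [H^1(-; F_p)] and injective on [H^2(-; F_p)]. The obstruction to lifting a
    cocycle through a central extension by [F_p] is a singular 2-cocycle, so by
    induction [f] induces a bijection [Hom(pi_1(Y), K) -> Hom(pi_1(X), K)] for
    every iterated central extension [K] by [F_p], hence for every finite
    p-group. The fundamental group of a compact manifold is finitely generated,
    so its quotients by the derived p-series are finite p-groups, and the
    bijections identify these quotients for the two sides of [f]. This applies
    to the inclusions of both ends into the cobordism. *)
From HB Require Import structures.
From mathcomp Require Import all_boot all_order all_algebra.
From mathcomp Require Import all_fingroup all_solvable generic_quotient finmap.
From mathcomp Require Import all_classical all_reals all_analysis.
From mathcomp Require Import homotopy lra.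
From mathcomp.multinomials Require Import freeg.
Require Import Defs.

Set Implicit Arguments.
Unset Strict Implicit.
Unset Printing Implicit Defensive.

Import Order.TTheory GRing.Theory Num.Theory numFieldNormedType.Exports.
Local Open Scope classical_set_scope.
Local Open Scope ring_scope.

(** * Finite p-quotients of groups *)

(** Unlike [{multiplicative G -> H}], this structure records [f 1 = 1]. *)
Notation hom := UMagmaMorphism.type.

(** The factor [G^(n)/G^(n+1)] is elementary abelian but in general not central in [G/G^(n+1)], so
    an induction along the series itself would call for cohomology with twisted coefficients.
    Refining to central extensions with kernel ['F_p] keeps all coefficients trivial. The price is
    finiteness: it is finite p-groups that are guaranteed a nontrivial centre at each stage, and
    this is where compactness enters. Comparing all homomorphisms into such groups then recovers the
    quotients by a Yoneda argument.

    Cohomology groups are never formed. Each cohomological statement concerns explicit functions on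
    singular simplices, and is obtained from homology by extending a partially defined functional on
    1-chains, which is possible because ['F_p] is a field. Cocycles live on all edges and not only
    on loops, so they can be read at any base point; this matters because the two ends meet the
    cobordism at unrelated base points. *)

Section MakeHom.
Variables (G H : groupType) (f : G -> H).
Hypothesis fM : {morph f : x y / (x * y)%g}.

Lemma morphM_eq1 : f 1%g = 1%g.
Proof. by apply: (@mulgI _ (f 1%g)); rewrite -fM !mulg1. Qed.

Definition mk_hom : hom G H :=
  HB.pack f (isMultiplicative.Build G H f fM)
    (Multiplicative_isUMagmaMorphism.Build G H f morphM_eq1).

End MakeHom.

Section PNilpotent.
Variable p : nat.
Local Open Scope group_scope.

(** In [pnil_extension] the kernel is presented by an embedding [i] of the additive group ['F_p], so
    that its elements can be handled as coefficients of cochains. *)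
Inductive pnil : groupType -> Prop :=
| pnil_trivial (G : groupType) : (forall x : G, x = 1) -> pnil G
| pnil_extension (G H : groupType) (f : hom G H)
    (i : 'F_p -> G) : pnil H -> (forall y, exists x, f x = y) ->
    {morph i : a b / (a + b)%R >-> a * b} -> injective i ->
    (forall a g, i a * g = g * i a) ->
    (forall g, f g = 1 <-> exists a, g = i a) -> pnil G.

(** A nontrivial finite p-group has a nontrivial centre, where Cauchy's theorem finds [z] of order
    [p]. The subgroup it generates is the kernel of the outermost extension, and the quotient is
    smaller. *)
Lemma pnil_pgroup (gT : finGroupType) :
  prime p -> (p.-group [set: gT]%SET)%g -> pnil gT.
Proof.
move=> pp; have [n] := ubnP #|[set: gT]%SET|.
elim: n gT => // n IH gT leTn pT.
have [T1|ntT] := eqVneq [set: gT]%SET 1%g.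
  apply: pnil_trivial => x; apply/set1gP; rewrite -T1 inE //.
have pZ : p.-group 'Z([set: gT]%SET)%g by apply: pgroupS pT; apply: center_sub.
have [|z zZ oz] := @Cauchy _ p 'Z([set: gT]%SET)%G pp.
  have := center_nil_eq1 (pgroup_nil pT); rewrite (negbTE ntT) => ntZ.
  by have [_ ? _] := pgroup_pdiv pZ (negbT ntZ).
have cz g : commute z g.
  by apply: (centP (fintype.subsetP (finset.subsetIr _ _) z zZ)); rewrite inE.
have nz : normal <[z]>%g [set: gT]%SET.
  apply: sub_center_normal; by rewrite cycle_subG.
have dom g : g \in 'N(<[z]>)%g by apply: (fintype.subsetP (normal_norm nz));
  rewrite inE.
pose f0 (g : gT) := coset <[z]>%G g.
have f0M : {morph f0 : x y / x * y} by move=> x y; apply: morphM.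
pose f : hom gT (coset_of <[z]>%G) :=
  @mk_hom gT (coset_of <[z]>%G) f0 f0M.
pose i (a : 'F_p) := (z ^+ a)%g.
have zp : (z ^+ p = 1)%g by rewrite -oz expg_order.
have eT : ([set: gT]%SET / <[z]> = [set: coset_of <[z]> ]%SET)%g.
  apply/setP => x; rewrite [RHS]inE; case: (cosetP x) => y _ ->.
  by apply: mem_quotient; rewrite inE.
apply: (@pnil_extension gT (coset_of <[z]>%G) f i).
- apply: IH; last by rewrite -eT quotient_pgroup.
  rewrite -eT; apply: (@leq_trans #|[set: gT]%SET|); last
    by rewrite ltnS in leTn.
  apply: ltn_quotient; rewrite ?finset.subsetT //.
  by rewrite cycle_eq1 -order_eq1 oz; case: (p) pp => [|[|]].
- by move=> y; case: (cosetP y) => x _ ->; exists x.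
- by move=> a b; rewrite /i /= -expgD expg_mod // Fp_cast.
- move=> a b /eqP; rewrite /i eq_expg_mod_order oz.
  have la (c : 'F_p) : (c < p)%N by rewrite -[X in (_ < X)%N](Fp_cast pp).
  by rewrite !modn_small // => /eqP/val_inj.
- by move=> a g; apply/commute_sym/commuteX/commute_sym/cz.
- move=> g; split=> [/(coset_idr (dom g))/cycleP[k ->]|[a ->]].
    have kp : (k %% p < (Zp_trunc (pdiv p)).+2)%N.
      by rewrite Fp_cast // ltn_mod prime_gt0.
    by exists (Ordinal kp); rewrite /i /= expg_mod.
  by apply: coset_id; rewrite mem_cycle.
Qed.

Lemma pnil_finite (G : groupType) : prime p -> finite_set [set: G] ->
  (forall x : G, exists n, x ^+ (p ^ n)%N = 1) -> pnil G.
Proof.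
(* [G] is unfolded for the group structure of [gT] to be convertible to it. *)
case: G => T c; destruct c; set G := Group.Pack _.
move=> pp /finite_seqP[s sE] Gp.
have us : finite_axiom (undup s).
  move=> x; rewrite count_uniq_mem ?undup_uniq // mem_undup.
  by have -> : x \in s by have : [set` s]%classic x by rewrite -sE.
have ks : pcancel (index^~ s) (fun n => nth None (map Some s) n).
  move=> x; have xs : x \in s by have : [set` s]%classic x by rewrite -sE. 
  by rewrite (nth_map x) ?index_mem // nth_index.
pose gT : finGroupType := HB.pack (Group.sort G)
  (PCanIsCountable ks) (fintype.isFinite.Build (G : Type) us).
apply: (@pnil_pgroup gT pp).
(* An element of prime order [q] is killed by a power of [p], which forces [q = p]. *)
apply/pgroupP => q pq /(Cauchy pq) [x _ ox].
have [n xn] := Gp x.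
have : (q %| p ^ n)%N by rewrite -ox order_dvdn; apply/eqP.
by rewrite Euclid_dvdX // dvdn_prime2 // => /andP[/eqP-> _]; rewrite inE.
Qed.

End PNilpotent.

Section QuotientMorphisms.
Variables (G : groupType) (N : normal_subgroup G).
Local Open Scope group_scope.
Local Open Scope quotient_scope.

Lemma quot_proj_is_multiplicative :
  {morph (\pi_(quotient_group N) : G -> quotient_group N) : x y / x * y}.
Proof. by move=> x y; rewrite /= (pi_qmul N). Qed.

Definition quot_proj : hom G (quotient_group N) :=
  mk_hom quot_proj_is_multiplicative.

Lemma quot_projE (x y : G) : quot_proj x = quot_proj y <-> nset N (x^-1 * y).
Proof. by split=> [/eqP/coset_eqP|/coset_eqP/eqP]. Qed.

Lemma quot_proj1 (x : G) : quot_proj x = 1 <-> nset N x.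
Proof.
rewrite -(gmulf1 (s := quot_proj)); split=> [/esym/quot_projE|Nx].
  by rewrite invg1 mul1g.
by apply/esym/quot_projE; rewrite invg1 mul1g.
Qed.

Lemma quot_reprK (q : quotient_group N) : quot_proj (repr q) = q.
Proof. exact: reprK. Qed.

Lemma quot_lift (K : groupType) (h : hom G K) :
  (forall x, nset N x -> h x = 1) ->
  exists h' : hom (quotient_group N) K,
    forall x, h' (quot_proj x) = h x.
Proof.
move=> hN; pose h' (q : quotient_group N) := h (repr q).
have h'E x : h' (quot_proj x) = h x.
  have /quot_projE/hN : quot_proj (repr (quot_proj x)) = quot_proj x.
    exact: quot_reprK.
  by rewrite gmulfM gmulfV => /mulg1_eq; rewrite invgK.
have h'M : {morph h' : x y / x * y}.
  move=> x y; rewrite -[x]quot_reprK -[y]quot_reprK -gmulfM !h'E.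
  exact: gmulfM.
by exists (mk_hom h'M).
Qed.

End QuotientMorphisms.

(** * The derived p-series under homomorphisms *)

Section DerivedSeries.
Variable p : nat.
Local Open Scope group_scope.

Lemma derived_pseries_morph (G K : groupType) (h : hom G K) n x :
  derived_pseries_set p n x -> derived_pseries_set p n (h x).
Proof.
elim: n x => [//|n IH] x /= Dx H sH; apply: (Dx [set z | H (h z)]).
split=> [|y]; first split=> [|a b Ha Hb] /=.
- by rewrite gmulf1; exact: sH.1.1.
- by rewrite gmulfF; exact: sH.1.2.
- case=> [[a Da] [b Db <-]|[a Da <-]] /=; apply: sH.2.
    left; exists (h a); first exact: IH.
    by exists (h b); [exact: IH|rewrite gmulfR].
  by right; exists (h a); [exact: IH|rewrite gmulfXn].
Qed.

Lemma derived_pseries_lift (G K : groupType) (h : hom G K) n y :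
  (forall y, exists x, h x = y) -> derived_pseries_set p n y ->
  exists2 x, derived_pseries_set p n x & h x = y.
Proof.
move=> hs; elim: n y => [|n IH] y /=; first by have [x] := hs y; exists x.
move=> Dy; apply: (Dy [set y | exists2 x, generated _ x & h x = y]).
split=> [|{Dy}y]; first split=> [|_ _ [a Ha <-] [b Hb <-]] /=.
- by exists 1; rewrite ?gmulf1 //; apply: (generated_subgroup _).1.
- by exists (a * b^-1); rewrite ?gmulfF //; apply: (generated_subgroup _).2.
- case=> [[a /IH[a' Da <-]] [b /IH[b' Db <-] <-]|[a /IH[a' Da <-] <-]] /=.
    exists [~ a', b']; rewrite ?gmulfR // => H sH; apply: sH.2; left.
    by exists a' => //; exists b'.
  by exists (a' ^+ p); rewrite ?gmulfXn // => H sH; apply: sH.2; right;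
    exists a'.
Qed.

(** A surjection carries the series onto the series. Consequently every homomorphism into such a
    quotient kills the [n]-th term of its source. *)
Lemma derived_pseries_quot (G : groupType) n
    (x : quotient_group (derived_pseries p G n)) :
  derived_pseries_set p n x -> x = 1.
Proof.
case/(@derived_pseries_lift _ _ (quot_proj (derived_pseries p G n))).
  by move=> y; exists (repr y); exact: quot_reprK.
by move=> y Dy <-; apply/quot_proj1.
Qed.

Lemma derived_pseries_quot_expg (G : groupType) n
    (x : quotient_group (derived_pseries p G n)) : x ^+ (p ^ n)%N = 1.
Proof.
rewrite -[x]quot_reprK -gmulfXn; apply/quot_proj1 => /=.
elim: n {x} (repr x) => [//|n IH] x /= H sH; apply: sH.2; right.
by exists (x ^+ (p ^ n)%N) => //; rewrite -expgnA -expnSr.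
Qed.

(** A Yoneda argument: existence, applied to the projection of [A], yields a left inverse of the map
    induced by [F]; uniqueness, applied to two maps from [B] to its own quotient, shows that it is
    also a right inverse. *)
Lemma isomorphic_derived_quotients (A B : groupType)
    (F : hom A B) n :
  pnil p (quotient_group (derived_pseries p A n)) ->
  pnil p (quotient_group (derived_pseries p B n)) ->
  (forall K, pnil p K -> forall f : hom A K,
     exists g : hom B K, forall a, g (F a) = f a) ->
  (forall K, pnil p K -> forall f g : hom B K,
     (forall a, f (F a) = g (F a)) -> f =1 g) ->
  isomorphic_groups (quotient_group (derived_pseries p A n))
    (quotient_group (derived_pseries p B n)).
Proof.
set QA := quotient_group _; set QB := quotient_group _ => pA pB ex un.
pose piA : hom A QA := quot_proj _.
pose piB : hom B QB := quot_proj _.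
have [g gE] := ex _ pA piA.
have [|g' g'E] := @quot_lift _ (derived_pseries p B n) _ g.
  by move=> x /(derived_pseries_morph g)/derived_pseries_quot.
have [|f fE] := @quot_lift _ (derived_pseries p A n) _ (piB \o F).
  by move=> x /(derived_pseries_morph (piB \o F))/derived_pseries_quot.
exists f; exists g' => [x|y].
  by rewrite -[x]quot_reprK fE /= [g' _]g'E gE.
rewrite -[y]quot_reprK g'E; apply: (un _ pB (f \o g) piB) => a /=.
by rewrite gE [f _]fE.
Qed.

End DerivedSeries.

Lemma isomorphic_groups_sym (G K : groupType) :
  isomorphic_groups G K -> isomorphic_groups K G.
Proof.
move=> [f [g fK gK]].
exists (mk_hom (can2_gmulfM fK gK)).
by exists f.
Qed.

Lemma isomorphic_groups_trans (G H K : groupType) :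
  isomorphic_groups G H -> isomorphic_groups H K -> isomorphic_groups G K.
Proof. by move=> [f bf] [g bg]; exists (g \o f); exact: bij_comp. Qed.

(** * Finiteness of the quotients of a finitely generated group *)

Section FinitelyGenerated.
Local Open Scope group_scope.

Definition fin_generated (G : groupType) (H : set G) : Prop :=
  exists2 S : set G, finite_set S & H = generated S.

Lemma sub_generated (G : groupType) (S : set G) : S `<=` generated S.
Proof. by move=> x Sx H sH; apply: sH.2. Qed.

Lemma generated_min (G : groupType) (S H : set G) :
  is_subgroup H -> S `<=` H -> generated S `<=` H.
Proof. by move=> sH SH x; apply. Qed.

(* Schreier's lemma: the [w (t * s)] are the Schreier generators. *)
Lemma fin_generated_normal (G : groupType) (N : normal_subgroup G) :
  fin_generated [set: G] -> finite_set [set: quotient_group N] ->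
  fin_generated (nset N).
Proof.
move=> [S finS GS] finQ.
pose r (q : quotient_group N) : G := repr q.
(* The representative of the trivial coset need not be [1], so [1] is added as a starting point. *)
pose T : set G := 1 |` range r.
pose S' : set G := 1 |` (S `|` [set x^-1 | x in S]).
pose w (x : G) : G := x * (r (quot_proj N x))^-1.
have Nw x : nset N (w x).
  by apply/quot_proj1; rewrite gmulfM gmulfV /r quot_reprK mulgV.
pose U : set G := [set w (t * s) | t in T & s in S'].
have sU := generated_subgroup U.
have wM t g h : w (t * (g * h)) = w (t * g) * w (r (quot_proj N (t * g)) * h).
  rewrite /w; have -> : quot_proj N (r (quot_proj N (t * g)) * h) =
      quot_proj N (t * (g * h)).
    by rewrite mulgA !(gmulfM _ h) /r quot_reprK.
  by rewrite !mulgA mulgVK.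
pose P : set G := [set g | forall t, T t -> generated U (w (t * g))].
have Tr q : T (r q) by right; exists q.
have PM x y : P x -> P y -> P (x * y).
  by move=> Px Py t Tt; rewrite wM; apply: subgroupM sU _ _; [exact: Px|exact:
    Py].
have PS s : S' s -> P s.
  by move=> Ss t Tt; apply: sub_generated; exists t => //; exists s.
(* Stability of [P] under inverses is not evident; hence the inverses of generators in [S'], and the
   two memberships carried together. *)
have allP g : P g.
  suff: generated S `<=` [set x | P x /\ P x^-1].
    by rewrite -GS => /(_ g I) [].
  apply: generated_min => [|s Ss].
    split; first by rewrite /= invg1; split; apply: PS; left.
    move=> x y [Px PVx] [Py PVy] /=; split; first exact: PM.
    by rewrite invgM invgK; exact: PM.
  by split; apply: PS; right; [left|right; exists s].
have finT : finite_set T.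
  by rewrite /T finite_setU; split; [exact: finite_set1|exact: finite_image].
have finS' : finite_set S'.
  rewrite /S' !finite_setU; split; first exact: finite_set1.
  by split=> //; exact: finite_image.
exists U; first exact: finite_image2.
apply/seteqP; split; last first.
  by apply: generated_min; [exact: normal_is_subgroup|move=> _ [t _ [s _ <-]]].
move=> g Ng; have T1 : T 1 by left.
(* [w g] and [w 1] end with the same factor, the inverse of the representative of the trivial coset;
   it cancels in their quotient and leaves [g]. *)
have := allP g 1 T1; have := allP 1 1 T1.
rewrite /w !mul1g; have -> : quot_proj N g = 1 by apply/quot_proj1.
by rewrite gmulf1 => U1 /sU.2/(_ U1); rewrite invgK mulgVK.
Qed.

Lemma generated_commuting_finite (G : groupType) (p : nat) (s : seq G) :
  (0 < p)%N -> {in s &, forall x y, x * y = y * x} ->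
  {in s, forall x, x ^+ p = 1} -> finite_set (generated [set` s]).
Proof.
move=> p0; elim: s => [|a s IH] cs ps.
  apply: (@sub_finite_set _ _ [set 1]); last exact: finite_set1.
  by apply: generated_min => //; split=> // x y -> ->; rewrite mulgV.
have {}IH : finite_set (generated [set` s]).
  by apply: IH => [x y xs ys|x xs]; [apply: cs|apply: ps];
    rewrite inE ?xs ?ys orbT.
have ap : a ^+ p = 1 by apply: ps; rewrite inE eqxx.
have ca : generated [set` s] `<=` [set x | commute a x].
  apply: generated_min => [|x xs]; last by apply: cs;
    rewrite inE ?eqxx ?xs ?orbT.
  split=> [|x y cx cy]; first exact: commute1.
  by apply: commuteM => //; exact: commuteV.
pose H : set G := [set a ^+ i * h | i in `I_p & h in generated [set` s]].
apply: (@sub_finite_set _ _ H); last exact: finite_image2.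
have sS := generated_subgroup [set` s].
have aH (i : nat) h : generated [set` s] h -> H (a ^+ i * h).
  move=> sh; exists (i %% p)%N; first by rewrite /= ltn_mod.
  by exists h => //; rewrite {2}(divn_eq i p) expgnDr mulnC expgnA ap expg1n
    mul1g.
apply: generated_min => [|x /=].
  split; first by rewrite -[1]mulg1 -(expg0 a); apply: aH; exact: sS.1.
  move=> _ _ [i ip [h sh <-]] [j jp [k sk <-]].
  have -> : a ^+ i * h * (a ^+ j * k)^-1 = a ^+ (i + (p - j)) * (h * k^-1).
    rewrite invgM mulgA -[_ * h * _]mulgA -mulgA -mulgA.
    have -> : (a ^+ j)^-1 = a ^+ (p - j).
      by apply: mulg1_eq; rewrite -expgnDr subnKC // ltnW.
    have /commuteX2 ch : commute a (h * k^-1) by apply: ca; apply: sS.2.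
    by rewrite expgnDr -mulgA; congr (_ * _); rewrite mulgA (ch _ 1%N).
  by apply: aH; apply: sS.2.
rewrite inE => /orP[/eqP->|xs].
  by rewrite -[a]mulg1 -{1}(expg1 a); apply: aH; exact: sS.1.
by rewrite -[x]mul1g -(expg0 a); apply: aH; exact: sub_generated.
Qed.

(** By induction the [n]-th term has finite index, so Schreier's lemma makes it finitely generated.
    Its image in the next quotient is then finitely generated, abelian and of exponent [p], hence
    finite, and finitely many translates of it cover that quotient. *)
Lemma derived_pseries_quot_finite (p : nat) (G : groupType) n : prime p ->
  fin_generated [set: G] ->
  finite_set [set: quotient_group (derived_pseries p G n)].
Proof.
move=> pp fG; elim: n => [|n IH].
  apply: (@sub_finite_set _ _ [set 1]); last exact: finite_set1.
  by move=> x _; rewrite -[x]quot_reprK; apply/quot_proj1.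
have [S finS DS] := fin_generated_normal fG IH.
have /finite_seqP [s sE] := finS; rewrite {}sE /= {S finS} in DS.
pose pi := quot_proj (derived_pseries p G n.+1).
have Ds x : x \in s -> derived_pseries_set p n x.
  by move=> xs; rewrite DS; exact: sub_generated.
have finD : finite_set (generated [set` map pi s]).
  apply: (@generated_commuting_finite _ p); first exact: prime_gt0.
    move=> _ _ /mapP[x /Ds Dx ->] /mapP[y /Ds Dy ->].
    apply/commgP/eqP; rewrite -gmulfR; apply/quot_proj1.
    by apply: sub_generated; left; exists x => //; exists y.
  move=> _ /mapP[x /Ds Dx ->]; rewrite -gmulfXn; apply/quot_proj1.
  by apply: sub_generated; right; exists x.
pose r (q : quotient_group (derived_pseries p G n)) : G := repr q.
apply: (@sub_finite_set _ _
  [set d * pi t | d in generated [set` map pi s] & t in range r]); last first.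
  by apply: finite_image2 => //; exact: finite_image.
move=> q _; rewrite -[q]quot_reprK -/pi; set g := repr q.
pose t := r (quot_proj (derived_pseries p G n) g).
have Dg : nset (derived_pseries p G n) (g * t^-1).
  by apply/quot_proj1; rewrite gmulfM gmulfV /t /r quot_reprK mulgV.
exists (pi (g * t^-1)); last first.
  by exists t; [exists (quot_proj (derived_pseries p G n) g)|rewrite -gmulfM
    mulgVK].
suff: generated [set` s] `<=` [set x | generated [set` map pi s] (pi x)].
  by apply; rewrite -DS.
have sS := generated_subgroup [set` map pi s].
apply: generated_min => [|x xs]; last by apply: sub_generated; exact: map_f.
split=> [|x y sx sy]; first by rewrite /mkset gmulf1; exact: sS.1.
by rewrite /mkset gmulfF; exact: sS.2.
Qed.

Lemma pnil_derived_quotient (p : nat) (G : groupType) n : prime p ->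
  fin_generated [set: G] ->
  pnil p (quotient_group (derived_pseries p G n)).
Proof.
move=> pp fG; apply: pnil_finite => //; first exact:
  derived_pseries_quot_finite.
by move=> x; exists n; exact: derived_pseries_quot_expg.
Qed.

End FinitelyGenerated.

(** * The path groupoid *)

Section PathGroupoid.
Variables (R : realType) (X : topologicalType).
Local Notation I := (unit_interval R).
Local Notation path a b := ({path I from a to b in X}).

(** For [a = b] this unfolds to [loop_homotopic], so homotopies found in the groupoid give
    equalities in [pi1] directly. Varying endpoints are needed because singular edges are not
    loops. *)
Definition path_homotopic (a b : X) (f g : path a b) : Prop :=
  exists H : continuousType (I * I)%type X,
    [/\ forall s, H (s, zero) = f s, forall s, H (s, one) = g s,
        forall t, H (zero, t) = a & forall t, H (one, t) = b].

Lemma path_homotopicI (a b : X) (f g : path a b) (H : I * I -> X) :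
  continuous H ->
  (forall s, H (s, zero) = f s) -> (forall s, H (s, one) = g s) ->
  (forall t, H (zero, t) = a) -> (forall t, H (one, t) = b) ->
  path_homotopic f g.
Proof. by move=> cH *; exists (mkcts cH). Qed.

Lemma clamp_le0 (r : R) : r <= 0 -> clamp r = zero :> I.
Proof.
move=> r0; apply: ival_inj.
by rewrite ival0 /ival set_valE /= max_l // ge_min r0 orbT.
Qed.

Lemma clamp_ge1 (r : R) : 1 <= r -> clamp r = one :> I.
Proof.
move=> r1; apply: ival_inj.
by rewrite ival1 /ival set_valE /= min_l // max_r.
Qed.

Lemma path_clamp_cts (T : topologicalType) a b (f : path a b) (u : T -> R) :
  continuous u -> continuous (fun t => f (clamp (u t))).
Proof.
move=> cu; apply: (@comp_cts _ _ _ u (f \o @clamp R)) => //.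
by apply: comp_cts; [exact: clamp_continuous | exact: cts_fun].
Qed.

Definition path_cat_fun a b c (f : path a b) (g : path b c) (s : I) : X :=
  if ival s <= 2^-1 then f (clamp (2 * ival s)) else g (clamp (2 * ival s - 1)).

Lemma path_cat_fun_continuous a b c (f : path a b) (g : path b c) :
  continuous (path_cat_fun f g).
Proof.
have c2 : continuous (fun s : I => 2 * ival s) by exact: ival_half_cts.
apply: continuous_piecewise.
- exact: ival_continuous.
- exact: path_clamp_cts.
- by apply: path_clamp_cts; apply: sub_cts; [exact: c2 | exact: cst_cts].
- move=> s ->; rewrite mulfV ?pnatr_eq0 // subrr.
  by rewrite clamp_ge1 // clamp_le0 // path_one path_zero.
Qed.

Lemma path_cat_fun_zero a b c (f : path a b) (g : path b c) :
  path_cat_fun f g zero = a.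
Proof.
by rewrite /path_cat_fun ival0 half_ge0 mulr0 clamp_le0 // path_zero.
Qed.

Lemma path_cat_fun_one a b c (f : path a b) (g : path b c) :
  path_cat_fun f g one = c.
Proof.
by rewrite /path_cat_fun ival1 half_ge1F clamp_ge1 ?path_one //; lra.
Qed.

Definition path_cat a b c (f : path a b) (g : path b c) : path a c :=
  mk_path (@path_cat_fun_continuous _ _ _ f g) (path_cat_fun_zero f g)
    (path_cat_fun_one f g).

Lemma path_catE a b c (f : path a b) (g : path b c) s : path_cat f g s =
  if ival s <= 2^-1 then f (clamp (2 * ival s)) else g (clamp (2 * ival s - 1)).
Proof. by []. Qed.

Definition path_inv_fun a b (f : path a b) (s : I) : X := f (itv_rev s).

Lemma path_inv_fun_continuous a b (f : path a b) : continuous (path_inv_fun f).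
Proof. by apply: comp_cts; [exact: itv_rev_continuous | exact: cts_fun]. Qed.

Lemma path_inv_fun_zero a b (f : path a b) : path_inv_fun f zero = b.
Proof. by rewrite /path_inv_fun itv_rev0 path_one. Qed.

Lemma path_inv_fun_one a b (f : path a b) : path_inv_fun f one = a.
Proof. by rewrite /path_inv_fun itv_rev1 path_zero. Qed.

Definition path_inv a b (f : path a b) : path b a :=
  mk_path (@path_inv_fun_continuous _ _ f) (path_inv_fun_zero f)
    (path_inv_fun_one f).

Lemma path_invE a b (f : path a b) s : path_inv f s = f (clamp (1 - ival s)).
Proof. by []. Qed.

Definition path_cst a : path a a := cst a.

Lemma path_homotopic_refl a b (f : path a b) : path_homotopic f f.
Proof.
apply: (@path_homotopicI _ _ _ _ (fun st => f st.1)) => //=.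
- by apply: (@comp_cts _ _ _ fst f); [exact: fst_cts | exact: cts_fun].
- by move=> _; exact: path_zero.
- by move=> _; exact: path_one.
Qed.

Lemma path_homotopic_sym a b (f g : path a b) :
  path_homotopic f g -> path_homotopic g f.
Proof.
move=> [H [H0 H1 Hz Ho]].
apply: (@path_homotopicI _ _ _ _ (fun st => H (st.1, itv_rev st.2))) => //=.
- apply: (@comp_cts _ _ _ (fun st : I * I => (st.1, itv_rev st.2)) H).
    apply: pair_cts; first exact: fst_cts.
    by apply: comp_cts; [exact: snd_cts | exact: itv_rev_continuous].
  exact: cts_fun.
- by move=> s; rewrite itv_rev0.
- by move=> s; rewrite itv_rev1.
Qed.

Lemma path_homotopic_trans a b (f g h : path a b) :
  path_homotopic f g -> path_homotopic g h -> path_homotopic f h.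
Proof.
move=> [H [H0 H1 Hz Ho]] [K [K0 K1 Kz Ko]].
have cu (k : R) :
    continuous (fun st : I * I => (st.1, clamp (2 * ival st.2 - k) : I)).
  apply: pair_cts; first exact: fst_cts.
  apply: (comp_cts _ (@clamp_continuous R)).
  apply: sub_cts; last exact: cst_cts.
  exact: (comp_cts (@snd_cts I I) (@ival_half_cts R)).
apply: (@path_homotopicI _ _ _ _ (fun st => if ival st.2 <= 2^-1
    then H (st.1, clamp (2 * ival st.2 - 0))
    else K (st.1, clamp (2 * ival st.2 - 1)))).
- apply: (@continuous_piecewise _ _ _ (fun st : I * I => ival st.2)).
  + exact: (comp_cts (@snd_cts I I) (@ival_continuous R)).
  + by apply: (comp_cts (cu 0)); exact: cts_fun.
  + by apply: (comp_cts (cu 1)); exact: cts_fun.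
  + move=> [s t] /= ->; rewrite clamp_ge1 ?clamp_le0 ?H1 ?K0 //; lra.
- by move=> s /=; rewrite ival0 half_ge0 clamp_le0 ?H0 //; lra.
- by move=> s /=; rewrite ival1 half_ge1F clamp_ge1 ?K1 //; lra.
- by move=> t /=; rewrite Hz Kz if_same.
- by move=> t /=; rewrite Ho Ko if_same.
Qed.

Lemma path_cat_homotopic a b c (f f' : path a b) (g g' : path b c) :
  path_homotopic f f' -> path_homotopic g g' ->
  path_homotopic (path_cat f g) (path_cat f' g').
Proof.
move=> [H [H0 H1 Hz Ho]] [K [K0 K1 Kz Ko]].
have cu (k : R) :
    continuous (fun st : I * I => (clamp (2 * ival st.1 - k) : I, st.2)).
  apply: pair_cts; last exact: snd_cts.
  apply: (comp_cts _ (@clamp_continuous R)).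
  apply: sub_cts; last exact: cst_cts.
  exact: (comp_cts (@fst_cts I I) (@ival_half_cts R)).
apply: (@path_homotopicI _ _ _ _ (fun st => if ival st.1 <= 2^-1
    then H (clamp (2 * ival st.1 - 0), st.2)
    else K (clamp (2 * ival st.1 - 1), st.2))).
- apply: (@continuous_piecewise _ _ _ (fun st : I * I => ival st.1)).
  + exact: (comp_cts (@fst_cts I I) (@ival_continuous R)).
  + by apply: (comp_cts (cu 0)); exact: cts_fun.
  + by apply: (comp_cts (cu 1)); exact: cts_fun.
  + move=> [s t] /= ->; rewrite clamp_ge1 ?clamp_le0 ?Ho ?Kz //; lra.
- by move=> s; rewrite /= path_catE subr0 H0 K0.
- by move=> s; rewrite /= path_catE subr0 H1 K1.
- by move=> t /=; rewrite ival0 half_ge0 clamp_le0 ?Hz //; lra.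
- by move=> t /=; rewrite ival1 half_ge1F clamp_ge1 ?Ko //; lra.
Qed.

(** The structure of an equiconnected space. It provides straight-line homotopies uniformly for the
    interval, the standard simplices and the convex pieces of charts, all of which are subtypes
    without linear structure. *)
Definition equiconnecting (S : topologicalType) (K : (S * S) * I -> S) : Prop :=
  [/\ continuous K, forall a b, K ((a, b), zero) = a,
      forall a b, K ((a, b), one) = b & forall a t, K ((a, a), t) = a].

Lemma path_homotopic_equiconnecting (S : topologicalType)
    (K : (S * S) * I -> S) (h : S -> X) (u v : I -> S) a b (f g : path a b) :
  equiconnecting K -> continuous h -> continuous u -> continuous v ->
  (forall s, f s = h (u s)) -> (forall s, g s = h (v s)) ->
  u zero = v zero -> u one = v one -> path_homotopic f g.
Proof.
move=> [cK K0 K1 Kt] ch cu cv fu gv uv0 uv1.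
apply: (@path_homotopicI _ _ _ _ (fun st => h (K ((u st.1, v st.1), st.2)))).
- apply: (@comp_cts _ _ _ (fun st : I * I => K ((u st.1, v st.1), st.2)) h) =>
  //.
  apply: (@comp_cts _ _ _ (fun st : I * I => ((u st.1, v st.1), st.2)) K) => //.
  apply: pair_cts; last exact: snd_cts.
  by apply: pair_cts; [exact: (comp_cts (@fst_cts I I) cu)
    |exact: (comp_cts (@fst_cts I I) cv)].
- by move=> s; rewrite /= K0 fu.
- by move=> s; rewrite /= K1 gv.
- by move=> t; rewrite /= uv0 Kt -gv path_zero.
- by move=> t; rewrite /= uv1 Kt -gv path_one.
Qed.

Definition itv_segment (abt : (I * I) * I) : I :=
  clamp ((1 - ival abt.2) * ival abt.1.1 + ival abt.2 * ival abt.1.2).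

Lemma itv_segment_equiconnecting : equiconnecting itv_segment.
Proof.
split.
- apply: (comp_cts _ (@clamp_continuous R)).
  have ct : continuous (fun abt : (I * I) * I => ival abt.2).
    exact: (comp_cts (@snd_cts _ I) (@ival_continuous R)).
  have c1 : continuous (fun abt : (I * I) * I => abt.1) by exact: fst_cts.
  apply: add_cts; apply: mul_cts => //.
  + by apply: sub_cts => //; exact: cst_cts.
  + exact: (comp_cts (comp_cts c1 (@fst_cts I I)) (@ival_continuous R)).
  + exact: (comp_cts (comp_cts c1 (@snd_cts I I)) (@ival_continuous R)).
- by move=> a b; rewrite /itv_segment /= ival0 subr0 mul1r mul0r addr0 ivalK.
- by move=> a b; rewrite /itv_segment /= ival1 subrr mul1r mul0r add0r ivalK.
- by move=> a t; rewrite /itv_segment /= -mulrDl subrK mul1r ivalK.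
Qed.

Lemma path_homotopic_reparam c d (h : path c d) a b (f g : path a b)
    (u v : I -> R) :
  continuous u -> continuous v ->
  (forall s, f s = h (clamp (u s))) -> (forall s, g s = h (clamp (v s))) ->
  u zero = v zero -> u one = v one -> path_homotopic f g.
Proof.
move=> cu cv fu gv uv0 uv1.
apply: (path_homotopic_equiconnecting (h := h) (u := fun s => clamp (u s))
  (v := fun s => clamp (v s)) itv_segment_equiconnecting) => //.
- exact: cts_fun.
- exact: (comp_cts cu (@clamp_continuous R)).
- exact: (comp_cts cv (@clamp_continuous R)).
- by rewrite uv0.
- by rewrite uv1.
Qed.

Lemma path_catf1 a b (f : path a b) : path_homotopic (path_cat f (path_cst b))
  f.
Proof.
apply: (@path_homotopic_reparam _ _ f _ _ _ _
  (fun s => if ival s <= 2^-1 then 2 * ival s else 1) (@ival R)).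
- apply: continuous_piecewise.
  + exact: ival_continuous.
  + exact: ival_half_cts.
  + exact: cst_cts.
  + by move=> t ->; lra.
- exact: ival_continuous.
- move=> s; rewrite path_catE; case: leP => // s2.
  by rewrite [RHS](_ : _ = f one) ?path_one // clamp_ge1.
- by move=> s; rewrite ivalK.
- by rewrite ival0 half_ge0 mulr0.
- by rewrite ival1 half_ge1F.
Qed.

Lemma path_cat1f a b (f : path a b) : path_homotopic (path_cat (path_cst a) f)
  f.
Proof.
apply: (@path_homotopic_reparam _ _ f _ _ _ _
  (fun s => if ival s <= 2^-1 then 0 else 2 * ival s - 1) (@ival R)).
- apply: continuous_piecewise.
  + exact: ival_continuous.
  + exact: cst_cts.
  + by apply: sub_cts; [exact: ival_half_cts | exact: cst_cts].
  + by move=> t ->; lra.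
- exact: ival_continuous.
- move=> s; rewrite path_catE; case: leP => // s2.
  by rewrite [RHS](_ : _ = f zero) ?path_zero // clamp_le0.
- by move=> s; rewrite ivalK.
- by rewrite ival0 half_ge0.
- by rewrite ival1 half_ge1F; lra.
Qed.

Lemma path_catVf a b (f : path a b) :
  path_homotopic (path_cat (path_inv f) f) (path_cst b).
Proof.
apply: (@path_homotopic_reparam _ _ f _ _ _ _ (fun s => if ival s <= 2^-1
  then 1 - 2 * ival s else 2 * ival s - 1) (fun=> 1)).
- apply: continuous_piecewise.
  + exact: ival_continuous.
  + by apply: sub_cts; [exact: cst_cts | exact: ival_half_cts].
  + by apply: sub_cts; [exact: ival_half_cts | exact: cst_cts].
  + by move=> t ->; lra.
- exact: cst_cts.
- move=> s; rewrite path_catE path_invE; case: leP => // s2.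
  by rewrite clampK //; have /andP[s0 s1] := ival_itv s; apply/andP; split; lra.
- by move=> s; rewrite clamp_ge1 // path_one.
- by rewrite ival0 half_ge0 mulr0 subr0.
- by rewrite ival1 half_ge1F; lra.
Qed.

Lemma path_catA a b c d (f : path a b) (g : path b c) (h : path c d) :
  path_homotopic (path_cat f (path_cat g h)) (path_cat (path_cat f g) h).
Proof.
(* The right-hand path runs through [f], [g], [h] on the intervals cut at 1/4 and 1/2; the piecewise
   formula gives the time at which the left-hand path, cut at 1/2 and 3/4, is at the same point. *)
apply: (@path_homotopic_reparam _ _ (path_cat f (path_cat g h)) _ _ _ _ (@ival
  R)
  (fun s => if ival s <= 4^-1 then 2 * ival s else
            if ival s <= 2^-1 then ival s + 4^-1 else 2^-1 * (ival s + 1))).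
- exact: ival_continuous.
- apply: continuous_piecewise.
  + exact: ival_continuous.
  + exact: ival_half_cts.
  + apply: continuous_piecewise.
    * exact: ival_continuous.
    * by apply: add_cts; [exact: ival_continuous | exact: cst_cts].
    * apply: mul_cts; first exact: cst_cts.
      by apply: add_cts; [exact: ival_continuous | exact: cst_cts].
    * by move=> t ->; lra.
  + move=> t ->; rewrite ifT; lra.
- by move=> s; rewrite ivalK.
- move=> s; have /andP[s0 s1] := ival_itv s.
  have E (r : R) : 0 <= r -> r <= 1 -> ival (clamp r) = r.
    by move=> r0 r1; rewrite clampK ?r0.
  have F (r r' : R) : r' < r -> (r <= r') = false by move=> ?; apply/lt_geF.
  have [s4|s4] := leP (ival s) 4^-1.
    have s2 : ival s <= 2^-1 by lra.
    rewrite [LHS]path_catE s2 [LHS]path_catE [RHS]path_catE.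
    by rewrite !E ?ifT //; lra.
  have [s2|s2] := leP (ival s) 2^-1.
    rewrite [LHS]path_catE s2 [LHS]path_catE E; [|lra..].
    rewrite F; [|lra]; rewrite [RHS]path_catE E; [|lra..].
    rewrite F; [|lra]; rewrite [RHS]path_catE E; [|lra..].
    by rewrite ifT; [congr (g (clamp _))|]; lra.
  rewrite [LHS]path_catE F // [RHS]path_catE E; [|lra..].
  rewrite F; [|lra]; rewrite [RHS]path_catE E; [|lra..].
  by rewrite F; [congr (h (clamp _))|]; lra.
- rewrite ival0 ifT; lra.
- rewrite ival1 half_ge1F ifF; first lra.
  by apply/negbTE; rewrite -ltNge; lra.
Qed.

Lemma path_cat_cancel a b c d (f : path a b) (g : path b c) (h : path c d) :
  path_homotopic (path_cat (path_inv f) (path_cat (path_cat f g) h))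
    (path_cat g h).
Proof.
apply: (@path_homotopic_trans _ _ _
    (path_cat (path_inv f) (path_cat f (path_cat g h)))).
  apply: path_cat_homotopic; first exact: path_homotopic_refl.
  exact: path_homotopic_sym (path_catA _ _ _).
apply: (path_homotopic_trans (path_catA _ _ _)).
apply: (path_homotopic_trans _ (path_cat1f _)).
apply: path_cat_homotopic; [exact: path_catVf|exact: path_homotopic_refl].
Qed.

End PathGroupoid.

(** * Classes of arbitrary paths in the fundamental group *)

Section UniversalCocycle.
Variables (R : realType) (X : topologicalType) (x : X).
Local Notation I := (unit_interval R).
Local Notation path a b := ({path I from a to b in X}).
Local Open Scope quotient_scope.

(** The path [al z] plays the role of a maximal tree based at [x]. *)
Variable al : forall z : X, path x z.

Definition path_class (a b : X) (f : path a b) : pi1 R x :=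
  \pi_(pi1 R x) (path_cat (path_cat (al a) f) (path_inv (al b))).

Lemma path_class_homotopic a b (f g : path a b) :
  path_homotopic f g -> path_class f = path_class g.
Proof.
move=> fg; apply/eqP/pi1_eqP; apply: path_cat_homotopic.
  by apply: path_cat_homotopic => //; exact: path_homotopic_refl.
exact: path_homotopic_refl.
Qed.

Lemma pi1_mulE (f g : path x x) :
  (\pi_(pi1 R x) f * \pi_(pi1 R x) g)%g = \pi_(pi1 R x) (path_cat f g).
Proof.
rewrite -[LHS](pi_pi1_mul f g); congr (\pi_(pi1 R x) _).
by apply/path_eqP => s; rewrite path_catE.
Qed.

Lemma path_class_cat a b c (f : path a b) (g : path b c) :
  path_class (path_cat f g) = (path_class f * path_class g)%g.
Proof.
rewrite pi1_mulE; apply/eqP/pi1_eqP; apply: path_homotopic_sym.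
apply: (path_homotopic_trans (path_homotopic_sym (path_catA _ _ _))).
apply: (@path_homotopic_trans _ _ _ _ _
    (path_cat (path_cat (al a) f) (path_cat g (path_inv (al c))))).
  apply: path_cat_homotopic; [exact: path_homotopic_refl|exact:
    path_cat_cancel].
apply: (path_homotopic_trans (path_catA _ _ _)).
apply: path_cat_homotopic; last exact: path_homotopic_refl.
exact: path_homotopic_sym (path_catA _ _ _).
Qed.

Lemma path_class_loop (f : path x x) :
  al x = path_cst R x -> path_class f = \pi_(pi1 R x) f.
Proof.
move=> alx; apply/eqP/pi1_eqP; rewrite alx.
apply: (@path_homotopic_trans _ _ _ _ _ (path_cat (path_cst R x) f)).
  have -> : path_inv (path_cst R x) = path_cst R x by apply/path_eqP.
  exact: path_catf1.
exact: path_cat1f.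
Qed.

End UniversalCocycle.

(** * Nonabelian 1-cocycles *)

Section ConvexSets.
Variable R : realType.
Local Notation I := (unit_interval R).

Lemma row_cts (T : topologicalType) n (f : T -> 'rV[R]_n) :
  (forall j, continuous (fun t => f t 0 j)) -> continuous f.
Proof.
move=> cf t A [P Pn sPA]; have Pt (j : 'I_n) : nbhs t [set w | P 0 j (f w 0 j)].
  exact: cf (Pn 0 j).
have : \forall w \near t, forall j, P 0 j (f w 0 j).
  exact: (@filter_forall _ _ _ (nbhs t) (nbhs_filter t) Pt).
by apply: filterS => w Pw; apply: sPA => a b; rewrite (ord1 a); exact: Pw.
Qed.

Lemma coord_cts (T : topologicalType) n (f : T -> 'rV[R]_n) j :
  continuous f -> continuous (fun t => f t 0 j).
Proof.
move=> cf t; apply: (@continuous_comp _ _ _ f (fun v : 'rV[R]_n => v 0 j)).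
  exact: cf.
exact: coord_continuous.
Qed.

Lemma sum_cts (T : topologicalType) (J : Type) (r : seq J) (f : J -> T -> R) :
  (forall j, continuous (f j)) -> continuous (fun t => \sum_(j <- r) f j t).
Proof.
move=> cf; elim: r => [|j r IH].
  by under [fun t => _]funext do rewrite big_nil; exact: cst_cts.
by under [fun t => _]funext do rewrite big_cons; exact: add_cts.
Qed.

Variables (n : nat) (S : set 'rV[R]_n).
Hypothesis cvxS : forall a b (t : R), S a -> S b -> 0 <= t <= 1 ->
  S ((1 - t) *: a + t *: b).

Lemma convex_segment_subproof (abt : (S * S) * I) :
  (1 - ival abt.2) *: set_val abt.1.1 + ival abt.2 *: set_val abt.1.2 \in S.
Proof. by apply/mem_set/cvxS; [exact: set_valP..|exact: ival_itv]. Qed.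

Definition convex_segment (abt : (S * S) * I) : S :=
  exist (fun y => y \in S) _ (convex_segment_subproof abt).

Lemma convex_segment_equiconnecting : equiconnecting convex_segment.
Proof.
split.
- apply: (@continuous_comp_initial _ _ _ set_val).
  apply: row_cts => j; rewrite /comp /=.
  have -> : (fun abt : (S * S) * I => set_val (convex_segment abt) 0 j) =
      (fun abt => (1 - ival abt.2) * set_val abt.1.1 0 j +
                  ival abt.2 * set_val abt.1.2 0 j).
    by apply/funext => abt; rewrite /convex_segment [LHS]mxE !mxE.
  have ct : continuous (fun abt : (S * S) * I => ival abt.2).
    exact: (comp_cts (@snd_cts _ I) (@ival_continuous R)).
  have c1 : continuous (fun abt : (S * S) * I => abt.1) by exact: fst_cts.
  have cv : continuous (set_val : S -> 'rV[R]_n) by exact: initial_continuous.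
  apply: add_cts; apply: mul_cts => //.
  + by apply: sub_cts => //; exact: cst_cts.
  + apply: coord_cts; exact: (comp_cts (comp_cts c1 (@fst_cts S S)) cv).
  + apply: coord_cts; exact: (comp_cts (comp_cts c1 (@snd_cts S S)) cv).
- by move=> a b; apply: val_inj; rewrite /= ival0 subr0 scale1r scale0r addr0.
- by move=> a b; apply: val_inj; rewrite /= ival1 subrr scale1r scale0r add0r.
- by move=> a t; apply: val_inj; rewrite /= -scalerDl subrK scale1r.
Qed.

End ConvexSets.

(** * Coordinates on simplices of low dimension *)

Section Simplices.
Variable R : realType.
Local Notation I := (unit_interval R).
Local Notation D k := (@std_simplex R k).

Lemma simplex_ge0 k (v : D k) j : 0 <= set_val v 0 j.
Proof. by have [h _] : @std_simplex R k (set_val v) by exact: set_valP. Qed.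

Lemma simplex_sum k (v : D k) : \sum_j set_val v 0 j = 1.
Proof. by have [_ h] : @std_simplex R k (set_val v) by exact: set_valP. Qed.

Lemma simplex_convex k (a b : 'rV[R]_k.+1) (t : R) :
  @std_simplex R k a -> @std_simplex R k b -> 0 <= t <= 1 ->
  @std_simplex R k ((1 - t) *: a + t *: b).
Proof.
move=> [a0 a1] [b0 b1] /andP[t0 t1]; split=> [j|].
  by rewrite !mxE addr_ge0 // mulr_ge0 // subr_ge0.
under eq_bigr do rewrite !mxE.
by rewrite big_split /= -!mulr_sumr a1 b1 !mulr1 subrK.
Qed.

(** The affine map with vertex values [a], for [a] with values in the unit interval; singular
    triangles in the interval and the square are built from such maps. *)
Definition affine k (a : 'I_k.+1 -> R) (v : D k) : I :=
  clamp (\sum_j a j * set_val v 0 j).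

Lemma affine_continuous k (a : 'I_k.+1 -> R) : continuous (affine a).
Proof.
apply: (comp_cts _ (@clamp_continuous R)).
apply: sum_cts => j; apply: mul_cts; first exact: cst_cts.
apply: coord_cts; exact: initial_continuous.
Qed.

Lemma affine_face k (a : 'I_k.+2 -> R) (i : 'I_k.+2) (v : D k) :
  affine a (face i v) = affine (fun j => a (fintype.lift i j)) v.
Proof.
rewrite /affine (bigD1_ord i) //= mxE unlift_none mulr0 add0r.
by congr clamp; apply: eq_bigr => j _; rewrite mxE liftK.
Qed.

Definition i1 : 'I_2 := fintype.lift ord0 ord0.

Lemma simplex1_itv (v : D 1) : 0 <= set_val v 0 i1 <= 1.
Proof.
rewrite simplex_ge0 /= -(simplex_sum v) big_ord_recl big_ord1 lerDr.
exact: simplex_ge0.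
Qed.

Lemma affine1E (a : 'I_2 -> R) (v : D 1) :
  affine a v = clamp (a ord0 + (a i1 - a ord0) * set_val v 0 i1).
Proof.
rewrite /affine; congr clamp; rewrite big_ord_recl big_ord1 -/i1.
have := simplex_sum v; rewrite big_ord_recl big_ord1 -/i1.
move: (set_val v 0 ord0) (set_val v 0 i1) => x y xy.
have -> : x = 1 - y by lra.
lra.
Qed.

Definition edge_coord (v : D 1) : I := clamp (set_val v 0 i1).

Lemma edge_coord_continuous : continuous edge_coord.
Proof.
apply: (comp_cts _ (@clamp_continuous R)).
apply: coord_cts; exact: initial_continuous.
Qed.

Lemma edge_point_subproof (t : I) :
  (\row_(j < 2) (if j == ord0 then 1 - ival t else ival t)) \in @std_simplex R
    1.
Proof.
have /andP[t0 t1] := ival_itv t.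
apply/mem_set; split=> [j|]; first by rewrite mxE; case: eqP => _ //;
  rewrite subr_ge0.
by rewrite big_ord_recl big_ord1 !mxE /= subrK.
Qed.

Definition edge_point (t : I) : D 1 := exist (fun y => y \in @std_simplex R 1) _
  (edge_point_subproof t).

Lemma edge_point_continuous : continuous edge_point.
Proof.
apply: (@continuous_comp_initial _ _ _ set_val).
apply: row_cts => j; rewrite /comp /=.
have -> : (fun t => set_val (edge_point t) 0 j) =
    fun t => if j == ord0 then 1 - ival t else ival t.
  by apply/funext => t; rewrite /edge_point [LHS]mxE.
case: eqP => _; last exact: ival_continuous.
by apply: sub_cts; [exact: cst_cts|exact: ival_continuous].
Qed.

Lemma edge_pointK : cancel edge_point edge_coord.
Proof. by move=> t; rewrite /edge_coord /edge_point set_valE /= mxE /= ivalK.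
  Qed.

Lemma ord2P (j : 'I_2) : j = ord0 \/ j = i1.
Proof. by case: (unliftP ord0 j) => [k ->|->]; [right; rewrite (ord1 k)|left].
  Qed.

Lemma edge_coordK : cancel edge_coord edge_point.
Proof.
move=> v; apply: val_inj; apply/rowP => j; rewrite /= mxE clampK ?simplex1_itv
  //.
have := simplex_sum v; rewrite big_ord_recl big_ord1 -/i1 => vs.
by have [->|->] := ord2P j; rewrite /=; lra.
Qed.

Lemma face_lift k (i : 'I_k.+2) (v : D k) j :
  set_val (face i v) 0 (fintype.lift i j) = set_val v 0 j.
Proof. by rewrite set_valE /= mxE liftK. Qed.

Lemma face_self k (i : 'I_k.+2) (v : D k) : set_val (face i v) 0 i = 0.
Proof. by rewrite set_valE /= mxE unlift_none. Qed.

End Simplices.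

HB.instance Definition _ (R : realType) :=
  isContinuous.Build _ _ (@edge_coord R) (@edge_coord_continuous R).
HB.instance Definition _ (R : realType) :=
  isContinuous.Build _ _ (@edge_point R) (@edge_point_continuous R).
HB.instance Definition _ (R : realType) k (a : 'I_k.+1 -> R) :=
  isContinuous.Build _ _ (affine a) (@affine_continuous R k a).

Definition j0 : 'I_3 := ord0.
Definition j1 : 'I_3 := fintype.lift ord0 ord0.
Definition j2 : 'I_3 := fintype.lift ord0 (fintype.lift ord0 ord0).

Lemma ord3P (j : 'I_3) : j = j0 \/ j = j1 \/ j = j2.
Proof. case: j => [[|[|[|]]]] // h; [left|right; left|right; right]; exact:
  val_inj. Qed.

Lemma simplex_ext (R : realType) k (v w : @std_simplex R k) :
  (forall m, set_val v 0 m = set_val w 0 m) -> v = w.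
Proof. by move=> vw; apply: val_inj; apply/rowP. Qed.

Lemma edge_pointE (R : realType) (t : unit_interval R) :
  (set_val (edge_point t) 0 ord0 = 1 - ival t) *
  (set_val (edge_point t) 0 i1 = ival t).
Proof. by split; rewrite set_valE /= mxE. Qed.

(** The edges [j2], [j0], [j1] run from vertex 0 to 1, from 1 to 2 and from 0 to 2; the equations
    are the coincidences at the vertices 0, 1 and 2. *)
Lemma triangle_vertices (R : realType) :
  [/\ face j2 (@edge_point R zero) = face j1 (edge_point zero),
      face j2 (@edge_point R one) = face j0 (edge_point zero) &
      face j0 (@edge_point R one) = face j1 (edge_point one)].
Proof.
have f00 (v : @std_simplex R 1) : set_val (face j0 v) 0 j0 = 0 :=
  face_self j0 v.
have f01 (v : @std_simplex R 1) : set_val (face j0 v) 0 j1 = set_val v 0 ord0.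
  by rewrite (_ : j1 = fintype.lift j0 ord0) ?face_lift //; exact: val_inj.
have f02 (v : @std_simplex R 1) : set_val (face j0 v) 0 j2 = set_val v 0 i1.
  by rewrite (_ : j2 = fintype.lift j0 i1) ?face_lift //; exact: val_inj.
have f10 (v : @std_simplex R 1) : set_val (face j1 v) 0 j0 = set_val v 0 ord0.
  by rewrite (_ : j0 = fintype.lift j1 ord0) ?face_lift //; exact: val_inj.
have f11 (v : @std_simplex R 1) : set_val (face j1 v) 0 j1 = 0 :=
  face_self j1 v.
have f12 (v : @std_simplex R 1) : set_val (face j1 v) 0 j2 = set_val v 0 i1.
  by rewrite (_ : j2 = fintype.lift j1 i1) ?face_lift //; exact: val_inj.
have f20 (v : @std_simplex R 1) : set_val (face j2 v) 0 j0 = set_val v 0 ord0.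
  by rewrite (_ : j0 = fintype.lift j2 ord0) ?face_lift //; exact: val_inj.
have f21 (v : @std_simplex R 1) : set_val (face j2 v) 0 j1 = set_val v 0 i1.
  by rewrite (_ : j1 = fintype.lift j2 i1) ?face_lift //; exact: val_inj.
have f22 (v : @std_simplex R 1) : set_val (face j2 v) 0 j2 = 0 :=
  face_self j2 v.
have fE := (f00, f01, f02, f10, f11, f12, f20, f21, f22).
split; apply: simplex_ext => j; have [->|[->|->]] := ord3P j;
  by rewrite !fE ?edge_pointE ?ival0 ?ival1 ?subrr ?subr0.
Qed.

(** * Cocycles and homomorphisms on the fundamental group *)

Section Cocycles.
Variables (R : realType) (X : topologicalType) (G : groupType).
Local Notation I := (unit_interval R).
Local Notation edge := (continuousType (@std_simplex R 1) X).
Local Notation path a b := ({path I from a to b in X}).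

(** The value on a singular 1-simplex is transported along it, so that these are
    the 1-cocycles with values in a possibly nonabelian group. *)
Definition cocycle (c : edge -> G) : Prop :=
  forall s : continuousType (@std_simplex R 2) X,
    (c (s \o face j2) * c (s \o face j0))%g = c (s \o face j1).

Definition edge_of (f : continuousType I X) : edge := f \o @edge_coord R.

Lemma eq_edge (c : edge -> G) (f g : edge) : f =1 g -> c f = c g.
Proof. by move=> /continuousEP ->. Qed.

Definition vertices (x y z : R) (j : 'I_3) : R := [:: x; y; z]`_j.

Lemma affine_face2 x y z (v : @std_simplex R 1) :
  affine (vertices x y z) (face j2 v) = clamp (x + (y - x) * set_val v 0 i1).
Proof. by rewrite affine_face affine1E. Qed.

Lemma affine_face0 x y z (v : @std_simplex R 1) :
  affine (vertices x y z) (face j0 v) = clamp (y + (z - y) * set_val v 0 i1).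
Proof. by rewrite affine_face affine1E. Qed.

Lemma affine_face1 x y z (v : @std_simplex R 1) :
  affine (vertices x y z) (face j1 v) = clamp (x + (z - x) * set_val v 0 i1).
Proof. by rewrite affine_face affine1E. Qed.

Variable c : edge -> G.
Hypothesis cc : cocycle c.

Lemma cocycle_cat a b d (f : path a b) (g : path b d) :
  c (edge_of (path_cat f g)) = (c (edge_of f) * c (edge_of g))%g.
Proof.
(* The triangle is flattened onto the interval with its middle vertex at the point where [f] meets
   [g]; its edges are then [f], [g] and their concatenation. *)
pose s := path_cat f g \o affine (vertices 0 2^-1 1).
have := cc s.
have c01 (r : R) : 0 <= r -> r <= 1 -> ival (clamp r) = r.
  by move=> r0 r1; rewrite clampK ?r0.
rewrite (@eq_edge _ (s \o face j2) (edge_of f)); last first.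
  move=> v; have /andP[v0 v1] := simplex1_itv v.
  rewrite /s /= affine_face2 path_catE c01; [|lra..].
  by case: leP => h; [rewrite /edge_coord; congr (f (clamp _))|exfalso]; lra.
rewrite (@eq_edge _ (s \o face j0) (edge_of g)); last first.
  move=> v; have /andP[v0 v1] := simplex1_itv v.
  rewrite /s /= affine_face0 path_catE c01; [|lra..].
  case: leP => h; last by rewrite /edge_coord; congr (g (clamp _)); lra.
  rewrite clamp_ge1 ?path_one; last lra.
  by rewrite /edge_coord clamp_le0 ?path_zero //; lra.
rewrite (@eq_edge _ (s \o face j1) (edge_of (path_cat f g))) => [->//|v].
by rewrite /s /= affine_face1 /edge_coord subr0 mul1r add0r.
Qed.

Lemma cocycle_cst (a : X) : c (edge_of (path_cst R a)) = 1%g.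
Proof.
have := cc (cst a); set e := c _ => ee.
have -> : c (edge_of (path_cst R a)) = e by apply: eq_edge.
apply: (mulgI e); rewrite mulg1 -[RHS](_ : c (cst a \o face j1) = e).
  by rewrite -ee; congr (_ * _)%g; apply: eq_edge.
exact: eq_edge.
Qed.

Lemma cocycle_homotopic a b (f g : path a b) :
  path_homotopic f g -> c (edge_of f) = c (edge_of g).
Proof.
move=> [H [H0 H1 Hz Ho]].
pose sq (p q : 'I_3 -> R) (v : @std_simplex R 2) := H (affine p v, affine q v).
have csq p q : continuous (sq p q).
  apply: (@comp_cts _ _ _ (fun v => (affine p v, affine q v)) H).
    by apply: pair_cts; exact: cts_fun.
  exact: cts_fun.
pose p1 := vertices 0 1 1; pose p2 := vertices 0 0 1.
have e0 (v : @std_simplex R 1) : clamp (0 + (0 - 0) * set_val v 0 i1) =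
  zero :> I.
  by rewrite clamp_le0 //; lra.
have e1 (v : @std_simplex R 1) : clamp (1 + (1 - 1) * set_val v 0 i1) =
  one :> I.
  by rewrite clamp_ge1 //; lra.
have e01 (v : @std_simplex R 1) :
    clamp (0 + (1 - 0) * set_val v 0 i1) = edge_coord v.
  by rewrite /edge_coord; congr clamp; lra.
pose s1 := mkcts (csq p1 p2); pose s2 := mkcts (csq p2 p1).
have s1E v : s1 v = H (affine p1 v, affine p2 v) by [].
have s2E v : s2 v = H (affine p2 v, affine p1 v) by [].
have E1 : c (s1 \o face j1) = c (edge_of f).
  rewrite -(cc s1) -[RHS]mulg1 -(cocycle_cst b).
  congr (_ * _)%g; apply: eq_edge => v;
    rewrite [LHS]s1E /p1 /p2 !(affine_face0, affine_face2) !(e0, e1, e01) ?H0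
      ?Ho //.
have E2 : c (s2 \o face j1) = c (edge_of g).
  rewrite -(cc s2) -[RHS]mul1g -(cocycle_cst a).
  congr (_ * _)%g; apply: eq_edge => v;
    rewrite [LHS]s2E /p1 /p2 !(affine_face0, affine_face2) !(e0, e1, e01) ?H1
      ?Hz //.
rewrite -E1 -E2; apply: eq_edge => v.
by rewrite [LHS]s1E [RHS]s2E /p1 /p2 !affine_face1.
Qed.

Lemma cocycle_inv a b (f : path a b) :
  c (edge_of (path_inv f)) = (c (edge_of f))^-1%g.
Proof.
apply: (mulIg (c (edge_of f))); rewrite mulVg -cocycle_cat -(cocycle_cst b).
exact: cocycle_homotopic (path_catVf f).
Qed.

Lemma cocycle_pi1 (x : X) : exists h : hom (pi1 R x) G,
  forall f : path x x, h (\pi_(pi1 R x)%qT f) = c (edge_of f).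
Proof.
pose h (a : pi1 R x) := c (edge_of (repr a)).
have hE (f : path x x) : h (\pi_(pi1 R x)%qT f) = c (edge_of f).
  by apply: cocycle_homotopic; apply/pi1_eqP; rewrite reprK.
have hM : {morph h : a b / (a * b)%g}.
  move=> a b; rewrite -[a]reprK -[b]reprK pi1_mulE !hE; exact: cocycle_cat.
by exists (mk_hom hM).
Qed.

End Cocycles.

Section PushPaths.
Variables (R : realType) (S X : topologicalType) (h : continuousType S X).
Local Notation I := (unit_interval R).

Lemma comp_path_cat (a b c : S) (p : {path I from a to b in S})
    (q : {path I from b to c in S}) :
  h \o path_cat p q =1 path_cat (h \o p) (h \o q).
Proof. by move=> s; rewrite /= !path_catE; case: ifP. Qed.

Lemma comp_path_homotopic (a b : S) (p q : {path I from a to b in S}) :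
  path_homotopic p q ->
  path_homotopic (h \o p : {path I from h a to h b in X}) (h \o q).
Proof.
move=> [H [H0 H1 Hz Ho]]; exists (h \o H).
by split=> s /=; rewrite ?H0 ?H1 ?Hz ?Ho.
Qed.

End PushPaths.

Section EdgeClasses.
Variables (R : realType) (X : topologicalType) (x : X).
Local Notation I := (unit_interval R).
Local Notation path a b := ({path I from a to b in X}).
Local Notation edge := (continuousType (@std_simplex R 1) X).
Variable al : forall z : X, path x z.

Lemma path_class_ext (a b a' b' : X) (f : path a b) (g : path a' b') :
  f =1 g -> path_class al f = path_class al g.
Proof.
move=> fg; have ea : a = a' by rewrite -(path_zero (s := f)) fg path_zero.
have eb : b = b' by rewrite -(path_one (s := f)) fg path_one.
by subst a' b'; congr path_class; apply/path_eqP.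
Qed.

Definition src (e : edge) : X := e (edge_point zero).
Definition tgt (e : edge) : X := e (edge_point one).

Definition path_of (e : edge) : path (src e) (tgt e) :=
  mk_path (@cts_fun _ _ (e \o @edge_point R)) erefl erefl.

Lemma path_ofK (e : edge) : edge_of (path_of e) =1 e.
Proof. by move=> v; rewrite /edge_of /= /mk_path /= edge_coordK. Qed.

(** The universal cocycle: by [cocycle_classE] every cocycle is a gauge transform of its image under
    a homomorphism. *)
Definition edge_class (e : edge) : pi1 R x := path_class al (path_of e).

Lemma edge_class_of (a b : X) (f : path a b) :
  edge_class (edge_of f) = path_class al f.
Proof.
by apply: path_class_ext => s; exact: (congr1 f (edge_pointK s)).
Qed.

Lemma edge_class_cocycle : cocycle edge_class.
Proof.
move=> s; pose e i : I -> @std_simplex R 2 := face i \o @edge_point R.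
have ce i : continuous (e i).
  by apply: comp_cts; [exact: edge_point_continuous|exact: face_continuous].
have [e10 e20 e11] := @triangle_vertices R.
pose p := mk_path (ce j2) erefl erefl.
pose q := mk_path (ce j0) (esym e20) erefl.
pose r := mk_path (ce j1) (esym e10) (esym e11).
(* Paths with common ends in the convex standard simplex are homotopic; [s] carries the homotopy to
   [X]. *)
have pqr : path_homotopic (path_cat p q) r.
  apply: (@path_homotopic_equiconnecting R _ _ _ id (path_cat p q) r _ _ _ _
    (convex_segment_equiconnecting (@simplex_convex R 2))) => //.
  - by move=> ?; exact: cvg_id.
  - exact: cts_fun.
  - exact: cts_fun.
  - exact: etrans (path_cat_fun_zero p q) e10.
  - exact: etrans (path_cat_fun_one p q) e11.
rewrite (_ : edge_class (s \o face j2) = path_class al (s \o p)); last first.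
  exact: path_class_ext.
rewrite (_ : edge_class (s \o face j0) = path_class al (s \o q)); last first.
  exact: path_class_ext.
rewrite (_ : edge_class (s \o face j1) = path_class al (s \o r)); last first.
  exact: path_class_ext.
rewrite -path_class_cat -(path_class_homotopic _ (comp_path_homotopic s pqr)).
by apply: path_class_ext => t; exact/esym/comp_path_cat.
Qed.

Hypothesis alx : al x = path_cst R x.

Lemma edge_class_loop (f : path x x) :
  edge_class (edge_of f) = \pi_(pi1 R x)%qT f.
Proof. by rewrite edge_class_of path_class_loop. Qed.

Lemma hom_cocycle (G : groupType) (h : hom (pi1 R x) G) :
  cocycle (fun e => h (edge_class e)).
Proof. by move=> s; rewrite -gmulfM edge_class_cocycle. Qed.

(** The gauge [g z] is the value of [c] on the tree path from [x] to [z]. *)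
Lemma cocycle_classE (G : groupType) (c : edge -> G) (h : hom (pi1 R x) G) :
  cocycle c -> (forall f : path x x, h (\pi_(pi1 R x)%qT f) = c (edge_of f)) ->
  exists g : X -> G,
    forall e, c e = ((g (src e))^-1 * (h (edge_class e) * g (tgt e)))%g.
Proof.
move=> cc hE; exists (fun z => c (edge_of (al z))) => e.
rewrite hE !cocycle_cat // cocycle_inv // mulgVK mulKg.
by apply: eq_edge => v; rewrite path_ofK.
Qed.

End EdgeClasses.

Lemma pullback_cocycle (R : realType) (X Y : topologicalType) (G : groupType)
    (f : continuousType X Y) (c : continuousType (@std_simplex R 1) Y -> G) :
  cocycle c -> cocycle (fun e => c (f \o e)).
Proof.
move=> cc s; rewrite -[RHS](_ : c ((f \o s) \o face j1) = _); last first.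
  exact: eq_edge.
by rewrite -cc; congr (_ * _)%g; apply: eq_edge.
Qed.

(** * Cochains with values in F_p *)

Section ExtendFunctional.
Variables (p : nat) (W : lmodType 'F_p).

Lemma Fp_scaleE (k : 'F_p) (w : W) : k *: w = w *+ k.
Proof. by rewrite -{1}[k]natr_Zp scaler_nat. Qed.

(** The graph of a partial additive map. Scalars of ['F_p] act by repeated addition, so a nonempty
    such graph is already a linear subspace. *)
Definition functional_graph (H : set (W * 'F_p)) : Prop :=
  (forall x y, H x -> H y -> H (x - y)) /\ (forall a, H (0, a) -> a = 0).

Lemma functional_graph_extension (H0 : set (W * 'F_p)) :
  H0 !=set0 -> functional_graph H0 ->
  exists l : {additive W -> 'F_p}, forall w a, H0 (w, a) -> l w = a.
Proof.
move=> [h0 H0h0] gH0.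
(* [set0] is allowed because it is the union of the empty chain. *)
pose P (H : set (W * 'F_p)) := H = set0 \/ H0 `<=` H /\ functional_graph H.
have [F FP Ftot|H [PH maxH]] := @Zorn_bigcup _ P.
  have [[K FK K0]|nK] := pselect (exists2 K, F K & K !=set0); last first.
    left; rewrite bigcup0 // => K FK; apply/seteqP; split=> // x Kx.
    by exfalso; apply: nK; exists K => //; exists x.
  have good L : F L -> L !=set0 -> H0 `<=` L /\ functional_graph L.
    by move=> FL [x Lx]; have [L0|//] := FP _ FL; rewrite L0 in Lx.
  right; split=> [x H0x|]; first by exists K => //; apply: (good K FK K0).1.
  split=> [x y [L FL Lx] [M FM My]|a [L FL La]]; last first.
    by apply: (good L FL _).2.2 => //; exists (0, a).
  have [LM|ML] := Ftot _ _ FL FM.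
    by exists M => //; apply: (good M FM _).2.1 => //; [exists y|exact: LM].
  by exists L => //; apply: (good L FL _).2.1 => //; [exists x|exact: ML].
have [sub [HB H00]] : H0 `<=` H /\ functional_graph H.
  case: PH => // H_0; exfalso; apply: (maxH H0); last by right; split.
  by rewrite H_0; split=> // /(_ _ H0h0).
have Hz : H (0, 0).
  by have := HB _ _ (sub _ H0h0) (sub _ H0h0); rewrite subrr.
have HN x : H x -> H (- x) by move=> Hx; rewrite -[- x]sub0r; apply: HB.
have HD x y : H x -> H y -> H (x + y).
  by move=> Hx Hy; rewrite -[y]opprK; apply: HB => //; exact: HN.
have Hn v a n : H (v, a) -> H (v *+ n, a *+ n).
  move=> Hx; elim: n => [|n IH]; rewrite ?mulr0n // !mulrS.
  exact: (HD (v, a) (v *+ n, a *+ n)).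
have Huniq w a b : H (w, a) -> H (w, b) -> a = b.
  move=> Ha Hb; apply/eqP; rewrite -subr_eq0; apply/eqP/H00.
  by have := HB _ _ Ha Hb; rewrite -[_ - _]/(w - w, a - b) subrr.
have total w : exists a, H (w, a).
  apply: contrapT => nw.
  (* [B] adjoins [w] to the domain with value [0]. *)
  pose B : set (W * 'F_p) := [set x | exists k : 'F_p, H (x.1 - k *: w, x.2)].
  apply: (maxH B).
    split=> [[v a] Hva|BH]; first by exists 0; rewrite scale0r subr0.
    by apply: nw; exists 0; apply: BH; exists 1; rewrite /= scale1r subrr.
  right; split=> [[v a] /sub Hva|]; first by exists 0; rewrite scale0r subr0.
  split=> [[v a] [v' a'] [k Hk] [k' Hk']|a [k /= Hk]].
    exists (k - k') => /=.
    have := HB _ _ Hk Hk'; congr H; congr (_, _).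
    by rewrite /= scalerBl [LHS]/= !opprD addrACA.
  have [k0|k0] := eqVneq k 0; first by move: Hk; rewrite k0 scale0r subr0;
    exact: H00.
  (* Here [- k *: w] lies in the domain, and division by [- k] would put [w] there. *)
  exfalso; apply: nw; exists (a *+ (- k^-1 : 'F_p)%R).
  have := Hn _ _ (- k^-1 : 'F_p)%R Hk; congr H; congr (_, _).
  by rewrite -Fp_scaleE sub0r scaleNr scalerN opprK scalerA mulVf // scale1r.
have [l lH] := choice total.
have lB : zmod_morphism l.
  by move=> x y; apply: Huniq (lH _) _; exact: HB (lH x) (lH y).
pose L : {additive W -> 'F_p} :=
  HB.pack l (GRing.isZmodMorphism.Build _ _ l lB).
exists L => w a /sub Hwa.
exact: Huniq (lH w) Hwa.
Qed.

End ExtendFunctional.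

(** * Evaluation of cochains on singular chains *)

Section Cochains.
Variables (R : realType) (p : nat).
Implicit Types (X Y : topologicalType).

Lemma freeg_chain_of k X (a : 'F_p) (s : continuousType (@std_simplex R k) X) :
  << a *g (s : singular_simplex R k X) >> = chain_of p s *+ a.
Proof. by rewrite -Fp_scaleE scale_freegU mulr1. Qed.

Lemma chain_ext k X (V : zmodType) (g h : {additive chain R p k X -> V}) :
  (forall s, g (chain_of p s) = h (chain_of p s)) -> g =1 h.
Proof.
move=> gh c; rewrite -[c]freeg_sumE !raddf_sum; apply: eq_bigr => s _.
by rewrite freeg_chain_of !raddfMn /= gh.
Qed.

Definition cochain_eval k X
    (b : continuousType (@std_simplex R k) X -> 'F_p) : chain R p k X -> 'F_p :=
  fglift (b : singular_simplex R k X -> GRing.regular 'F_p).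

Lemma cochain_eval_is_additive k X b : zmod_morphism (@cochain_eval k X b).
Proof.
exact: (@lift_is_additive _ (singular_simplex R k X) (GRing.regular 'F_p) b).
Qed.

HB.instance Definition _ k X b :=
  GRing.isZmodMorphism.Build _ _ (@cochain_eval k X b)
    (@cochain_eval_is_additive k X b).

Lemma cochain_evalE k X b (s : continuousType (@std_simplex R k) X) :
  cochain_eval b (chain_of p s) = b s.
Proof. by rewrite /cochain_eval liftU scale1r. Qed.

Lemma boundary_edge X (e : continuousType (@std_simplex R 1) X) :
  boundary (chain_of p e) =
    chain_of p (e \o face ord0) - chain_of p (e \o face i1).
Proof.
rewrite /boundary liftU scale1r !big_ord_recl big_ord0 /= /bump /=.
by rewrite expr0 expr1 scale1r scaleN1r addr0.
Qed.

Lemma boundary_tri X (s : continuousType (@std_simplex R 2) X) :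
  boundary (chain_of p s) = chain_of p (s \o face j0)
    - chain_of p (s \o face j1) + chain_of p (s \o face j2).
Proof.
rewrite /boundary liftU scale1r !big_ord_recl big_ord0 /= /bump /=.
rewrite expr0 expr1 sqrrN expr1n !scale1r scaleN1r addr0.
by rewrite addrA.
Qed.

Definition k0 : 'I_4 := ord0.
Definition k1 : 'I_4 := fintype.lift ord0 ord0.
Definition k2 : 'I_4 := fintype.lift ord0 (fintype.lift ord0 ord0).
Definition k3 : 'I_4 :=
  fintype.lift ord0 (fintype.lift ord0 (fintype.lift ord0 ord0)).

Lemma boundary_tet X (s : continuousType (@std_simplex R 3) X) :
  boundary (chain_of p s) = chain_of p (s \o face k0)
    - chain_of p (s \o face k1) + chain_of p (s \o face k2)
    - chain_of p (s \o face k3).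
Proof.
rewrite /boundary liftU scale1r !big_ord_recl big_ord0 /= /bump /=.
by rewrite expr0 expr1 sqrrN expr1n exprS sqrrN expr1n mulr1 !scale1r !scaleN1r
  addr0 !addrA.
Qed.

Lemma chain_map_of k X Y (f : continuousType X Y)
    (s : continuousType (@std_simplex R k) X) :
  chain_map f (chain_of p s) = chain_of p (f \o s).
Proof. by rewrite /chain_map liftU scale1r. Qed.

End Cochains.

Section HomologyMaps.
Variables (R : realType) (p : nat) (X Y : topologicalType).
Variable f : continuousType X Y.

Lemma homology_map_injP k (z : chain R p k.+1 X) (w : chain R p k.+2 Y) :
  injective (@homology_map R p k.+1 X Y f) ->
  boundary z = 0 -> chain_map f z = boundary w ->
  exists v : chain R p k.+2 X, z = boundary v.
Proof.
move=> inj z0 fz.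
have zc : z \in @cycle R p k.+1 X by rewrite unfold_in z0.
pose zz : cycles R p k.+1 X := Sub z zc.
have : homology_map f (\pi_{ideal_quot (@bounding R p k.+1 X)}%qT zz) =
       homology_map f (\pi_{ideal_quot (@bounding R p k.+1 X)}%qT 0).
  rewrite !homology_map_pi; apply/eqP; rewrite -Quotient.idealrBE.
  by apply/asboolP; exists w; rewrite !raddfB /= raddf0 subr0 -fz.
move=> /inj/eqP; rewrite -Quotient.idealrBE => /asboolP[v vz].
by exists v; rewrite vz subr0.
Qed.

Lemma homology_map_surjP k (z : chain R p k.+1 Y) :
  (forall h, exists h', @homology_map R p k.+1 X Y f h' = h) ->
  boundary z = 0 ->
  exists (z' : chain R p k.+1 X) (w : chain R p k.+2 Y),
    boundary z' = 0 /\ z = chain_map f z' + boundary w.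
Proof.
move=> sur z0.
have zc : z \in @cycle R p k.+1 Y by rewrite unfold_in z0.
pose zz : cycles R p k.+1 Y := Sub z zc.
have [h'] := sur (\pi_{ideal_quot (@bounding R p k.+1 Y)}%qT zz).
rewrite -[h']reprK homology_map_pi => /esym/eqP.
rewrite -Quotient.idealrBE => /asboolP[w wz].
exists (val (repr h')), w; split; first exact/eqP/(valP (repr h')).
by rewrite wz raddfB /= addrC subrK.
Qed.

End HomologyMaps.

Section FacesOfFaces.
Variable R : realType.

(** Two double faces agree if they omit the same two vertices and list the others in the same order;
    for concrete indices both conditions are decided by computation. *)
Lemma face_face (i i' : 'I_4) (j j' : 'I_3) (v : @std_simplex R 1) :
  (forall m, (m == i) || (m == fintype.lift i j) =
             (m == i') || (m == fintype.lift i' j')) ->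
  (forall l, fintype.lift i (fintype.lift j l) =
             fintype.lift i' (fintype.lift j' l)) ->
  face i (face j v) = face i' (face j' v).
Proof.
have vanish (a : 'I_4) (b : 'I_3) m : (m == a) || (m == fintype.lift a b) ->
    set_val (face a (face b v)) 0 m = 0.
  by case/orP => /eqP ->; rewrite ?face_self // face_lift face_self.
move=> mE lE; apply: simplex_ext => m.
have [mij|] := boolP ((m == i) || (m == fintype.lift i j)).
  by rewrite !vanish // -mE.
case: (unliftP i m) => [m' ->|->]; last by rewrite eqxx.
case: (unliftP j m') => [l ->|->]; last by rewrite eqxx orbT.
by rewrite !face_lift lE !face_lift.
Qed.

(** Each of the six edges of a tetrahedron is shared by two of its faces. *)
Lemma tet_faces (X : topologicalType) (t : continuousType (@std_simplex R 3) X)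
  :
  [/\ ((t \o face k3) \o face j2 =1 (t \o face k2) \o face j2),
      ((t \o face k3) \o face j0 =1 (t \o face k0) \o face j2) &
      ((t \o face k3) \o face j1 =1 (t \o face k1) \o face j2)] /\
  [/\ ((t \o face k0) \o face j0 =1 (t \o face k1) \o face j0),
      ((t \o face k0) \o face j1 =1 (t \o face k2) \o face j0) &
      ((t \o face k1) \o face j1 =1 (t \o face k2) \o face j1)].
Proof.
by split; split=> v; rewrite /=; congr (t _); apply: face_face;
  case=> [[|[|[|[|]]]]] // h; apply: val_inj.
Qed.

Lemma simplex0_point_subproof :
  (const_mx 1 : 'rV[R]_1) \in @std_simplex R 0.
Proof.
by apply/mem_set; split=> [j|]; rewrite ?mxE ?ler01 // big_ord1 mxE.
Qed.

Definition simplex0_point : @std_simplex R 0 :=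
  exist (fun y => y \in @std_simplex R 0) _ simplex0_point_subproof.

Lemma face0_ends (v : @std_simplex R 0) :
  face ord0 v = edge_point one /\ face i1 v = edge_point zero.
Proof.
have v1 : set_val v 0 ord0 = 1 by rewrite -(simplex_sum v) big_ord1.
have e0 : ord0 = fintype.lift i1 (ord0 : 'I_1) by exact: val_inj.
split; apply: simplex_ext => m; have [->|->] := ord2P m;
  rewrite edge_pointE ?ival0 ?ival1.
- by rewrite face_self subrr.
- by rewrite face_lift v1.
- by rewrite e0 face_lift v1 subr0.
- by rewrite face_self.
Qed.

End FacesOfFaces.

(** * Cohomology in degrees 1 and 2 along [f] *)

Section CochainExtensions.
Variables (R : realType) (p : nat) (X Y : topologicalType).
Variable f : continuousType X Y.
Local Notation edge T := (continuousType (@std_simplex R 1) T).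
Local Notation tri T := (continuousType (@std_simplex R 2) T).
Local Notation I := (unit_interval R).

Hypothesis H1inj : injective (@homology_map R p 1 X Y f).
Hypothesis H1surj : forall h, exists h', @homology_map R p 1 X Y f h' = h.
Hypothesis H2surj : forall h, exists h', @homology_map R p 2 X Y f h' = h.

Lemma chain_ext0 k (T : topologicalType) (V : zmodType)
    (g : {additive chain R p k T -> V}) :
  (forall s, g (chain_of p s) = 0) -> forall c, g c = 0.
Proof.
move=> g0 c; rewrite -[c]freeg_sumE raddf_sum big1 // => s _.
by rewrite freeg_chain_of raddfMn /= g0 mul0rn.
Qed.

Lemma chain_of_eq k (T : topologicalType)
    (s t : continuousType (@std_simplex R k) T) :
  s =1 t -> chain_of p s = chain_of p t.
Proof. by move=> /continuousEP ->. Qed.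

Lemma boundary_loop (T : topologicalType) (e : edge T) :
  src e = tgt e -> boundary (chain_of p e) = 0.
Proof.
move=> ste; rewrite boundary_edge (@chain_of_eq _ _ _ (e \o face i1)) ?subrr //
  => v.
by have [h0 h1] := face0_ends v; rewrite /= h0 h1; exact: esym ste.
Qed.

Lemma cocycle_boundary (T : topologicalType) (c : edge T -> 'F_p) :
  cocycle c -> forall w : chain R p 2 T, cochain_eval c (boundary w) = 0.
Proof.
move=> cc; apply: (@chain_ext0 _ _ _ (cochain_eval c \o @boundary R p 1 T)) =>
  s.
rewrite /= boundary_tri raddfD raddfB /= !cochain_evalE -cc.
by rewrite [(_ * _)%g]addrC opprD addrA subrr add0r addNr.
Qed.

(** Surjectivity on first cohomology. Prescribe [c] on cycles coming from [X] and [0] on boundaries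
    of [Y]: injectivity on [H_1] makes this consistent, and any additive extension is a cocycle
    because it kills boundaries. Off the cycles nothing is controlled, hence agreement on closed
    edges only. *)
Lemma cocycle_extension (c : edge X -> 'F_p) : cocycle c ->
  exists2 c' : edge Y -> 'F_p, cocycle c' &
    forall e : edge X, src e = tgt e -> c' (f \o e) = c e.
Proof.
move=> cc; pose H0 : set (chain R p 1 Y * 'F_p) := [set u | exists z w,
  [/\ boundary z = 0, u.1 = chain_map f z + boundary w & u.2 =
    cochain_eval c z]].
have [||l lE] := @functional_graph_extension p (chain R p 1 Y) H0.
- by exists (0, 0); exists 0, 0; rewrite /= !raddf0 addr0.
- split=> [[u1 u2] [v1 v2] [z [w [z0 /= -> ->]]] [z' [w' [z0' /= -> ->]]]|a].
    exists (z - z'), (w - w'); rewrite /= !raddfB /= z0 z0' subrr.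
    by rewrite opprD addrACA.
  move=> [z [w [z0 /= fzw ->]]].
  have [v ->] : exists v, z = boundary v.
    apply: (homology_map_injP (w := - w) H1inj z0).
    by rewrite raddfN; apply/eqP; rewrite -addr_eq0 -fzw.
  exact: cocycle_boundary.
exists (fun e => l (chain_of p e)) => [s|e ste].
  have /eqP : l (boundary (chain_of p s)) = 0.
    by apply: lE; exists 0, (chain_of p s); rewrite /= !raddf0 add0r.
  by rewrite boundary_tri raddfD raddfB /= addrAC subr_eq0 addrC => /eqP.
rewrite -chain_map_of -(cochain_evalE c e); apply: lE.
by exists (chain_of p e), 0; rewrite raddf0 addr0 boundary_loop.
Qed.

(** Injectivity on second cohomology. The rule sending [boundary t] to the value of [o] on [t] is
    consistent: by surjectivity on [H_2] a 2-cycle of [Y] is a boundary plus the image of a cycle of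
    [X], and on the latter [o] is the coboundary of [b]. The resulting [b'] is not claimed to
    restrict to [b]. *)
Lemma coboundary_extension (o : tri Y -> 'F_p) (b : edge X -> 'F_p) :
  (forall t : continuousType (@std_simplex R 3) Y,
    o (t \o face k0) + o (t \o face k2) = o (t \o face k1) + o (t \o face k3))
      ->
  (forall s : tri X, o (f \o s) =
    b (s \o face j0) - b (s \o face j1) + b (s \o face j2)) ->
  exists b' : edge Y -> 'F_p, forall s : tri Y, o s =
    b' (s \o face j0) - b' (s \o face j1) + b' (s \o face j2).
Proof.
move=> oc ob.
have o0 (w : chain R p 3 Y) : cochain_eval o (boundary w) = 0.
  move: w; apply: (@chain_ext0 _ _ _ (cochain_eval o \o @boundary R p 2 Y)) =>
    t.
  rewrite /= boundary_tet !(raddfB, raddfD) /= !cochain_evalE.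
  by rewrite [X in X - _]addrAC oc [X in X - _ - _]addrC addrK subrr.
have ofb (z : chain R p 2 X) :
    cochain_eval o (chain_map f z) = cochain_eval b (boundary z).
  move: z; apply: (@chain_ext _ _ _ _ _ (cochain_eval o \o @chain_map R p 2 X Y
    f)
    (cochain_eval b \o @boundary R p 1 X)) => s.
  by rewrite /= chain_map_of boundary_tri !(raddfB, raddfD) /= !cochain_evalE
    ob.
pose H0 : set (chain R p 1 Y * 'F_p) :=
  range (fun t : chain R p 2 Y => (boundary t, cochain_eval o t)).
have [||l lE] := @functional_graph_extension p (chain R p 1 Y) H0.
- by exists (boundary 0, cochain_eval o 0); exists 0.
- split=> [_ _ [t _ <-] [t' _ <-]|a [t _ [t0 <-]]].
    by exists (t - t') => //; rewrite !raddfB.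
  have [z [w [z0 ->]]] := homology_map_surjP H2surj t0.
  by rewrite raddfD /= o0 ofb z0 raddf0 addr0.
exists (fun e => l (chain_of p e)) => s.
rewrite -(cochain_evalE o s) -(lE (boundary (chain_of p s)) (cochain_eval o _)).
  by rewrite boundary_tri !(raddfB, raddfD).
by exists (chain_of p s).
Qed.

Variables (x : X) (al : forall z : X, {path I from x to z in X}).

(** Injectivity on first cohomology. The pullback of [c] is trivial on loops, hence the coboundary
    of a function [g] on points. By surjectivity on [H_1] a closed edge of [Y] is homologous to the
    image of a cycle of [X], where coboundaries vanish. *)
Lemma cocycle_loops_eq0 (c : edge Y -> 'F_p) : cocycle c ->
  (forall g : {path I from x to x in X}, c (f \o edge_of g) = 0) ->
  forall e : edge Y, src e = tgt e -> c e = 0.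
Proof.
move=> cc c0 e ste.
have [h hE] := cocycle_pi1 (pullback_cocycle f cc) x.
have [g gE] := cocycle_classE al (pullback_cocycle f cc) hE.
pose g0 (s : continuousType (@std_simplex R 0) X) := g (s (simplex0_point R)).
have [z [w [z0 ez]]] := homology_map_surjP H1surj (boundary_loop ste).
rewrite -(cochain_evalE c e) ez raddfD /= cocycle_boundary // addr0.
rewrite (_ : 0 = cochain_eval g0 (boundary z)); last by rewrite z0 raddf0.
move: z {z0 ez}; apply: (@chain_ext _ _ _ _ _ (cochain_eval c \o @chain_map R p
  1 X Y f)
    (cochain_eval g0 \o @boundary R p 0 X)) => s.
rewrite /= chain_map_of boundary_edge raddfB /= !cochain_evalE gE /g0 /=.
have [-> ->] := face0_ends (simplex0_point R).
have -> : h (edge_class al s) = 0.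
  by rewrite -[edge_class al s]reprK hE c0.
by rewrite mul1g [LHS]addrC.
Qed.

End CochainExtensions.

(** * Stallings' theorem for iterated central extensions by F_p *)

Section Extension.
Variables (p : nat) (G H : groupType) (F : hom G H) (i : 'F_p -> G).
Local Open Scope group_scope.
Hypothesis iD : {morph i : a b / (a + b)%R >-> a * b}.
Hypothesis i_inj : injective i.
Hypothesis iC : forall a g, i a * g = g * i a.
Hypothesis kerF : forall g, F g = 1 <-> exists a, g = i a.

Lemma central0 : i 0%R = 1.
Proof. by apply: (mulgI (i 0%R)); rewrite -iD addr0 mulg1. Qed.

Lemma F_central a : F (i a) = 1.
Proof. by apply/kerF; exists a. Qed.

Lemma central_diff g h : F g = F h -> exists a, g = i a * h.
Proof.
move=> gh; have /kerF[a ga] : F (g * h^-1) = 1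
  by rewrite gmulfM gmulfV gh mulgV.
by exists a; rewrite -ga mulgVK.
Qed.

Lemma central_mulACA a b g h : (i a * g) * (i b * h) = i (a + b)%R * (g * h).
Proof. by rewrite iD !mulgA -[i a * i b * g]mulgA (iC b g) mulgA. Qed.

(** With [hom_twist]: the lifts of a homomorphism through a central extension, if any, form a torsor
    under the homomorphisms into the kernel. *)
Lemma hom_diff (K : groupType) (u v : hom K G) : (forall a, F (u a) =
  F (v a)) ->
  exists d : hom K 'F_p, forall a, u a = i (d a) * v a.
Proof.
move=> uv; have [d dE] := choice (fun a => central_diff (uv a)).
have dM : {morph d : a b / a * b >-> a * b}.
  move=> a b; apply: i_inj; apply: (mulIg (v (a * b))).
  by rewrite -dE !gmulfM !dE central_mulACA.
by exists (mk_hom dM).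
Qed.

Lemma hom_twist (K : groupType) (d : hom K 'F_p) (v : hom K G) :
  exists u : hom K G, forall a, u a = i (d a) * v a.
Proof.
have uM : {morph (fun a => i (d a) * v a) : a b / a * b}.
  by move=> a b; rewrite /= !gmulfM central_mulACA.
by exists (mk_hom uM).
Qed.

End Extension.

(** * Homomorphisms into iterated central extensions *)

Section Stallings.
Variables (R : realType) (p : nat) (X Y : topologicalType).
Variable f : continuousType X Y.
Local Notation edge T := (continuousType (@std_simplex R 1) T).
Local Notation tri T := (continuousType (@std_simplex R 2) T).
Local Notation I := (unit_interval R).

Hypothesis H1inj : injective (@homology_map R p 1 X Y f).
Hypothesis H1surj : forall h, exists h', @homology_map R p 1 X Y f h' = h.
Hypothesis H2surj : forall h, exists h', @homology_map R p 2 X Y f h' = h.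

Variables (x : X) (alX : forall z : X, {path I from x to z in X}).
Hypothesis alXx : alX x = path_cst R x.
Variables (y : Y) (alY : forall z : Y, {path I from y to z in Y}).
Hypothesis alYy : alY y = path_cst R y.

(** The map induced by [f], with loops at [f x] brought to [y] along the tree [alY]; thus [f x] and
    [y] may differ. *)
Variable Phi : hom (pi1 R x) (pi1 R y).
Hypothesis PhiE : forall g : {path I from x to x in X},
  Phi (\pi_(pi1 R x)%qT g) = edge_class alY (f \o edge_of g).

Local Open Scope group_scope.

Lemma src_loop (T : topologicalType) (z : T) (g : {path I from z to z in T}) :
  src (edge_of g) = tgt (edge_of g).
Proof. by rewrite /src /tgt /edge_of /= !edge_pointK path_zero path_one. Qed.

Lemma gauge_cocycle (T : topologicalType) (G : groupType) (c : edge T -> G)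
    (g : T -> G) :
  cocycle c -> cocycle (fun e => (g (src e))^-1 * (c e * g (tgt e))).
Proof.
move=> cc s; have [e1 e2 e3] := triangle_vertices R; rewrite /= e1 e2 e3.
by rewrite -cc !mulgA mulgK.
Qed.

Lemma Fp_hom_extension (k : hom (pi1 R x) 'F_p) :
  exists k' : hom (pi1 R y) 'F_p, forall a, k' (Phi a) = k a.
Proof.
have [c cc cE] := cocycle_extension H1inj (hom_cocycle alX k).
have [h hE] := cocycle_pi1 cc y; exists h => a.
have [g gE] := cocycle_classE alY cc hE.
(* On a closed edge the two gauge factors cancel, ['F_p] being abelian. *)
rewrite -[a]reprK PhiE -(edge_class_loop alXx) -cE ?src_loop // gE.
have -> : src (f \o edge_of (repr a)) = tgt (f \o edge_of (repr a)).
  exact: (congr1 f (src_loop (repr a))).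
by rewrite [_ * g _]addrC mulKg.
Qed.

Lemma Fp_hom_trivial (k : hom (pi1 R y) 'F_p) :
  (forall a, k (Phi a) = 1) -> forall b, k b = 1.
Proof.
move=> k1 b; rewrite -[b]reprK -(edge_class_loop alYy).
apply: (cocycle_loops_eq0 H1surj alX (hom_cocycle alY k)); last exact: src_loop.
by move=> g; rewrite -PhiE k1.
Qed.

Lemma pnil_hom_extension (G : groupType) : pnil p G ->
  forall u : hom (pi1 R x) G,
    exists v : hom (pi1 R y) G, forall a, v (Phi a) = u a.
Proof.
elim=> {G} [G G1 u|G H F i _ IH Fs iD i_inj iC kerF u].
  have oM : {morph (fun _ : pi1 R y => 1 : G) : a b / a * b} by move=> *;
    rewrite mulg1.
  by exists (mk_hom oM) => a; rewrite [RHS]G1 [LHS]G1.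
have [v' v'E] := IH (F \o u).
pose c' (e : edge Y) := v' (edge_class alY e).
have cc' : cocycle c' := hom_cocycle alY v'.
(* The cocycle of [u] lies over the pullback of [c'] only up to a gauge transformation in [H];
   lifting the gauge to [G] gives a cocycle lying over it exactly. *)
have [e eE cce] : exists2 e : edge X -> G, (forall s, F (e s) = c' (f \o s)) &
  cocycle e.
  have hE (g : {path I from x to x in X}) :
      (F \o u) (\pi_(pi1 R x)%qT g) = c' (f \o edge_of g).
    by rewrite -v'E PhiE.
  have [g gE] := cocycle_classE alX (pullback_cocycle f cc') hE.
  have [g' g'E] := choice (fun z => Fs (g z)).
  exists (fun s => (g' (src s))^-1 * (u (edge_class alX s) * g' (tgt s))).
    by move=> s; rewrite gE !gmulfM gmulfV !g'E.
  exact: gauge_cocycle (hom_cocycle alX u).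
have [sec secE] := choice Fs.
pose ct (s : edge Y) := sec (c' s).
have Fct s : F (ct s) = c' s by exact: secE.
(* [ct] lifts [c'] to [G]; its failure to be a cocycle is the class [w]. *)
have /choice[w wE] : forall s : tri Y, exists a,
    ct (s \o face j2) * ct (s \o face j0) = i a * ct (s \o face j1).
  move=> s; apply: (central_diff kerF).
  by rewrite gmulfM !Fct cc'.
(* Over [X] the cochain [ct] and the cocycle [e] lie over the same values, so they differ by a
   central [b], whose coboundary is the pullback of [w]. *)
have /choice[b bE] : forall s : edge X, exists a, ct (f \o s) = i a * e s.
  by move=> s; apply: (central_diff kerF); rewrite Fct eE.
have ctE (s t : edge Y) : s =1 t -> ct s = ct t by move=> /continuousEP ->.
have [||b' b'E] := @coboundary_extension _ _ _ _ f H2surj w b.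
- move=> t; have [[t1 t2 t3] [t4 t5 t6]] := tet_faces t.
  have := wE (t \o face k0); have := wE (t \o face k1).
  have := wE (t \o face k2); have := wE (t \o face k3).
  rewrite (ctE _ _ t1) (ctE _ _ t2) (ctE _ _ t3) (ctE _ _ t4).
  rewrite (ctE _ _ t5) (ctE _ _ t6).
  set a01 := ct ((t \o face k2) \o face j2).
  set a12 := ct ((t \o face k0) \o face j2).
  set a02 := ct ((t \o face k1) \o face j2).
  set a13 := ct ((t \o face k2) \o face j0).
  set a03 := ct ((t \o face k2) \o face j1).
  set a23 := ct ((t \o face k1) \o face j0).
  (* Associativity of [a01 * a12 * a23] is the cocycle identity for [w]: the two bracketings pass
     through [a02] and through [a13], and the central factors move out. *)
  move=> E3 E2 E1 E0; apply: i_inj; rewrite !iD; apply: (mulIg a03).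
  rewrite -[LHS]mulgA -E2 [LHS]mulgA (iC _ a01) -[LHS]mulgA -E0 [LHS]mulgA E3.
  by rewrite -[LHS]mulgA E1 [LHS]mulgA iC.
- move=> s; have := wE (f \o s).
  have fE j : ct ((f \o s) \o face j) = i (b (s \o face j)) * e (s \o face j).
    by rewrite -bE; exact: ctE.
  rewrite !fE (central_mulACA iD iC) cce.
  rewrite mulgA -iD => /mulIg/i_inj/esym/(canRL (addrK _)) ->.
  by rewrite [X in X - _]addrC addrAC.
(* As [b'] has coboundary [w], this central correction turns [ct] into a cocycle that still lies
   over [c']. *)
pose c s := i (- b' s)%R * ct s.
have cc : cocycle c.
  move=> s; rewrite /c (central_mulACA iD iC) wE mulgA -iD b'E; congr (i _ * _).
  rewrite -opprD [X in _ + X]addrAC addrA.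
  by rewrite [X in - X]addrC addNr add0r.
have Fc s : F (c s) = c' s by rewrite gmulfM (F_central kerF) mul1g Fct.
have [v0 v0E] := cocycle_pi1 cc y.
have Fv0 a : F (v0 a) = v' a.
  rewrite -[a]reprK v0E Fc /c' (edge_class_loop alYy) //.
(* [v0] lifts [v'] but gives back [u] only up to a homomorphism [d] into the kernel; extending [d]
   over [Y] and twisting [v0] by it repairs this. *)
have [d dE] := hom_diff iD i_inj iC kerF (u := u) (v := v0 \o Phi)
  (fun a => etrans (esym (v'E a)) (esym (Fv0 (Phi a)))).
have [d' d'E] := Fp_hom_extension d.
have [v vE] := hom_twist iD iC d' v0.
by exists v => a; rewrite vE d'E dE.
Qed.

(** By induction [u] and [v] agree in [H], so they differ by a homomorphism into ['F_p] that
    vanishes on the image of [Phi], hence everywhere. *)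
Lemma pnil_hom_uniqueness (G : groupType) : pnil p G ->
  forall u v : hom (pi1 R y) G, (forall a, u (Phi a) = v (Phi a)) -> u =1 v.
Proof.
elim=> {G} [G G1 u v _ a|G H F i _ IH Fs iD i_inj iC kerF u v uv].
  by rewrite [LHS]G1 [RHS]G1.
have Fuv : forall a, F (u a) = F (v a).
  by apply: (IH (F \o u) (F \o v)) => a /=; rewrite uv.
have [d dE] := hom_diff iD i_inj iC kerF Fuv.
have d1 a : d (Phi a) = 1.
  apply: i_inj; rewrite [RHS](central0 iD); apply: (mulIg (v (Phi a))).
  by rewrite -dE uv mul1g.
by move=> a; rewrite dE (Fp_hom_trivial d1) [i _](central0 iD) mul1g.
Qed.

End Stallings.

(** * Fundamental groups of compact manifolds *)

Section SimpleSets.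
Variable R : realType.
Local Notation I := (unit_interval R).

(** The homotopy between two paths of [U] may leave [U], since only classes in [X] are compared. *)
Definition simple_open (X : topologicalType) (U : set X) : Prop :=
  [/\ open U,
      forall a b, U a -> U b ->
        exists g : {path I from a to b in X}, forall t, U (g t) &
      forall a b (g h : {path I from a to b in X}),
        (forall t, U (g t)) -> (forall t, U (h t)) -> path_homotopic g h].

Definition simple_basis (X : topologicalType) : Prop :=
  forall (z : X) (O : set X), open O -> O z ->
    exists U, [/\ simple_open U, U z & U `<=` O].

Lemma lt_norm_convex (r a b t e : R) : 0 <= t <= 1 ->
  `|r - a| < e -> `|r - b| < e -> `|r - ((1 - t) * a + t * b)| < e.
Proof.
move=> /andP[t0 t1] ra rb; pose M := Num.max `|r - a| `|r - b|.
have -> : r - ((1 - t) * a + t * b) = (1 - t) * (r - a) + t * (r - b) by lra.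
apply: (@le_lt_trans _ _ M); last by rewrite gt_max ra.
apply: le_trans (ler_normD _ _) _; rewrite !normrM (ger0_norm t0) [ `|1 - t|
  ]ger0_norm ?subr_ge0 //.
have -> : M = (1 - t) * M + t * M by lra.
by apply: lerD; apply: ler_wpM2l; rewrite ?subr_ge0 // le_max lexx ?orbT.
Qed.

Lemma manifold_simple_basis m (X : topologicalType) :
  manifold R m X -> simple_basis X.
Proof.
move=> [_ _ chartX] z O oO Oz; have [c Dz] := chartX z.
set D := chart_dom c in Dz *; pose cm := @chart_map R m X c.
have oD : open D := chart_dom_open c.
pose z' : set_type D := exist (fun y => y \in D) z (mem_set Dz).
pose OD : set (set_type D) := set_val @^-1` O.
have oOD : open OD by exists O.
have [V' oV' VE] : open (cm @` OD) := chart_open oOD.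
pose w0 : 'rV[R]_m := set_val (cm z').
have /nbhs_ballP[e /= e0 eV'] : nbhs w0 V'.
  apply: open_nbhs_nbhs; split=> //.
  have : (cm @` OD) (cm z') by exists z'.
  by rewrite -VE.
(* An open cube: its trace [S] on the half-space is convex, which treats interior and boundary
   points alike. *)
pose B : set 'rV[R]_m := [set v | forall j, `|w0 0 j - v 0 j| < e].
have BV' : B `<=` V'.
  by move=> v Bv; apply: eV'; split=> // i j; rewrite (ord1 i); exact: Bv.
have oB : open B.
  rewrite openE => v Bv; rewrite /interior /=.
  apply: (@filter_forall _ _ _ (nbhs v) (nbhs_filter v)) => j.
  have cj : continuous (fun w : 'rV[R]_m => `|w0 0 j - w 0 j|).
    apply: (comp_cts _ (@norm_continuous R R)).
    by apply: sub_cts; [exact: cst_cts|exact: coord_continuous].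
  exact: (cj v _ (lt_nbhsl (Bv j))).
have Bw0 : B w0 by move=> j; rewrite subrr normr0.
pose S : set 'rV[R]_m := (@half_space R m) `&` B.
have cvxS a b (t : R) : S a -> S b -> 0 <= t <= 1 -> S ((1 - t) *: a + t *: b).
  move=> [ha Ba] [hb Bb] t01; split=> [i i0|j]; rewrite !mxE; last exact:
    lt_norm_convex.
  case/andP: t01 => t0 t1; rewrite addr_ge0 // mulr_ge0 ?subr_ge0 //; [exact:
    ha|exact: hb].
pose incl (v : S) : set_type (@half_space R m) :=
  exist (fun y => y \in @half_space R m) (set_val v) (mem_set (set_valP v).1).
have cincl : continuous incl.
  by apply: (@continuous_comp_initial _ _ _ set_val); exact: initial_continuous.
(* The map [s] below is the inverse of the chart on [S], which is in the image of the chart because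
   [B] lies inside [V']. *)
have lift v : exists u : set_type D, cm u = incl v.
  have : (set_val @^-1` V') (incl v) by apply: BV'; exact: (set_valP v).2.
  by rewrite VE => -[u _ uv]; exists u.
have [g gE] := choice lift.
pose s (v : S) : X := set_val (g v).
have cs : continuous s.
  apply/continuousP => A oA.
  have oAD : open (set_val @^-1` A : set (set_type D)) by exists A.
  have := chart_open oAD; move/(continuousP _).1: cincl => /[apply].
  congr open; apply/seteqP; split=> v /=.
    by move=> [u Au uv]; rewrite /s (_ : g v = u) //; apply:
      (@chart_injective _ _ _ c); rewrite -/cm gE.
  by move=> Av; exists (g v) => //; rewrite gE.
pose P : set (set_type D) := cm @^-1` (set_val @^-1` B).
have [W oW PE] : open P.
  have oP' : open (set_val @^-1` B : set (set_type (@half_space R m)))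
    by exists B.
  by move/(continuousP _).1: (@chart_continuous _ _ _ c); exact.
pose U : set X := D `&` W.
have US v : U (s v).
  split; first exact: set_valP.
  suff : P (g v) by rewrite -PE.
  by rewrite /P /= gE; exact: (set_valP v).2.
have lift_path (a b : X) (h : {path I from a to b in X}) :
  (forall t, U (h t)) ->
    exists2 k : I -> S, continuous k & forall t, h t = s (k t).
  move=> Uh.
  pose u (t : I) : set_type D := exist (fun y => y \in D) (h t) (mem_set (Uh
    t).1).
  have cu : continuous u.
    by apply: (@continuous_comp_initial _ _ _ set_val); exact: cts_fun.
  have Su t : S (set_val (cm (u t))).
    split; first exact: set_valP.
    have : (set_val @^-1` W) (u t) by exact: (Uh t).2.
    by rewrite PE.
  pose k (t : I) : S := exist (fun y => y \in S) _ (mem_set (Su t)).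
  exists k => [|t]; last first.
    rewrite /s (_ : g (k t) = u t) //; apply: (@chart_injective _ _ _ c).
    by rewrite -/cm gE; exact: val_inj.
  apply: (@continuous_comp_initial _ _ _ set_val).
  have ccmu := comp_cts cu (@chart_continuous _ _ _ c).
  have civ : continuous (set_val : set_type (@half_space R m) -> 'rV[R]_m).
    exact: initial_continuous.
  exact: (comp_cts ccmu civ).
exists U; split; last 2 first.
- split=> //; have : (set_val @^-1` W) z' by rewrite PE.
  by [].
- move=> a [Da Wa]; pose u : set_type D := exist (fun y => y \in D) a (mem_set
  Da).
  have : (set_val @^-1` W) u by [].
  rewrite PE => /BV' V'u; have : (set_val @^-1` V') (cm u) by [].
  by rewrite VE => -[u' Ou' /chart_injective u'u]; rewrite u'u in Ou'.
split; first exact: openI.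
- move=> a b Ua Ub.
  have Uca t : U (path_cst R a t) by [].
  have Ucb t : U (path_cst R b t) by [].
  have [ka _ kaE] := lift_path _ _ _ Uca; have [kb _ kbE] :=
    lift_path _ _ _ Ucb.
  have [cK K0 K1 _] := convex_segment_equiconnecting cvxS.
  pose h (t : I) := s (convex_segment cvxS ((ka zero, kb zero), t)).
  have ch : continuous h.
    apply: (comp_cts _ cs); apply: (comp_cts _ cK).
    by apply: pair_cts; [exact: cst_cts|move=> ?; exact: cvg_id].
  have h0 : h zero = a by rewrite /h K0 -kaE.
  have h1 : h one = b by rewrite /h K1 -kbE.
  by exists (mk_path ch h0 h1) => t; exact: US.
- move=> a b h h' Uh Uh'.
  have [k ck kE] := lift_path _ _ _ Uh; have [k' ck' k'E] :=
    lift_path _ _ _ Uh'.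
  have s_inj v v' : s v = s v' -> v = v'.
    move=> /val_inj vv'; apply: val_inj.
    have : incl v = incl v' by rewrite -gE vv' gE.
    by move=> /(congr1 set_val).
  apply: (path_homotopic_equiconnecting (convex_segment_equiconnecting cvxS) cs
    ck ck' kE k'E).
    by apply: s_inj; rewrite -kE -k'E !path_zero.
  by apply: s_inj; rewrite -kE -k'E !path_one.
Qed.

End SimpleSets.

(** * Connectedness and compactness *)

Section ConnectedSpaces.
Variable R : realType.
Local Notation I := (unit_interval R).

Lemma connected_locally_constant (T : topologicalType) (P : T -> Prop) (a : T) :
  connected [set: T] -> (forall t, nbhs t [set t' | P t' <-> P t]) ->
  P a -> forall t, P t.
Proof.
move=> conT locP Pa t.
have oP (Q : T -> Prop) : (forall t, nbhs t [set t' | Q t' <-> Q t]) ->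
    open [set t | Q t].
  move=> locQ; rewrite openE => u Qu; rewrite /interior /=.
  by apply: filterS (locQ u) => v /= ->.
suff: [set t | P t] = [set: T] by move=> PT; have : [set t | P t] t
  by rewrite PT.
apply: conT; first by exists a.
  by exists [set t | P t]; [exact: oP|rewrite setTI].
exists [set t | P t]; last by rewrite setTI.
rewrite -openC; apply: (oP (fun t => ~ P t)) => u.
by apply: filterS (locP u) => v /= [vu uv]; split; exact: contra_not.
Qed.

Lemma itv_connected : connected [set: I].
Proof.
have -> : [set: I] = @clamp R @` `[0 : R, 1]%classic.
  apply/seteqP; split=> // t _; exists (ival t); last exact: ivalK.
  by rewrite /= in_itv /= ival_itv.
apply: connected_continuous_connected; first exact: segment_connected.
exact/continuous_subspaceT/clamp_continuous.
Qed.

Definition path_connected (X : topologicalType) : Prop :=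
  forall a b : X, exists g : {path I from a to b in X}, True.

Lemma connected_path_connected (X : topologicalType) :
  simple_basis R X -> connected [set: X] -> path_connected X.
Proof.
move=> sX conX a; apply: (connected_locally_constant conX (a := a)); last first.
  by exists (path_cst R a).
move=> b; have [U [[oU pU _] Ub _]] := sX b setT openT Logic.I.
have : nbhs b U by apply: open_nbhs_nbhs.
apply: filterS => c Uc; split=> -[g _].
  by have [h _] := pU _ _ Uc Ub; exists (path_cat g h).
by have [h _] := pU _ _ Ub Uc; exists (path_cat g h).
Qed.

(* [compact_cover] is stated for pointed spaces only; [X] is unfolded for its
   topology to be convertible to that of [pX]. *)
Lemma compact_cover_compact (X : topologicalType) (C : set X) :
  compact C -> cover_compact C.
Proof.
move=> cC; have [C0|] := eqVneq C set0.
  by rewrite C0 => J D f _ _; exists finmap.fset0.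
case/set0P => x _; case: X C x cC => T c; destruct c; set X :=
  Topological.Pack _.
move=> C x cC.
pose pX : ptopologicalType := HB.pack (Topological.sort X)
  (isPointed.Build (Topological.sort X) x).
have <- : @compact pX = @cover_compact pX := @compact_cover pX.
exact: cC.
Qed.

Lemma compact_finite_image (X : topologicalType) (T : Type) (C : set X)
    (F : X -> T) : compact C ->
  (forall z, C z -> nbhs z [set z' | C z' -> F z' = F z]) ->
    finite_set (F @` C).
Proof.
move=> /compact_cover_compact cC locF.
pose O (z : X) := [set z' | C z' -> F z' = F z]^°.
have [||D DC Dcov] := cC X C O.
- by move=> z _; exact: open_interior.
- by move=> z Cz; exists z => //; exact: locF.
apply: (@sub_finite_set _ _ (F @` [set` D])); last exact: finite_image.
move=> _ [z Cz <-]; have [d Dd /interior_subset Ozd] := Dcov z Cz.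
by exists d => //; rewrite Ozd.
Qed.

End ConnectedSpaces.

(** * Finite generation of the fundamental group *)

Section SubPaths.
Variables (R : realType) (X : topologicalType) (x : X).
Local Notation I := (unit_interval R).
Variable al : forall z : X, {path I from x to z in X}.

Lemma itv_segment_path (s t : I) : exists h : {path I from s to t in I},
  forall r, h r = itv_segment ((s, t), r).
Proof.
have [cK K0 K1 _] := itv_segment_equiconnecting R.
have ch : continuous (fun r => itv_segment ((s, t), r)).
  apply: (comp_cts _ cK).
  by apply: pair_cts; [exact: cst_cts|move=> ?; exact: cvg_id].
by exists (mk_path ch (K0 s t) (K1 s t)).
Qed.

(** For [t] before [s] the restriction is run backwards, so [path_class_sub_cat] holds for times in
    any order. *)
Definition sub_path (g : continuousType I X) (s t : I) :
    {path I from g s to g t in X} :=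
  g \o projT1 (cid (itv_segment_path s t)).

Lemma sub_pathE g s t r : sub_path g s t r = g (itv_segment ((s, t), r)).
Proof. by rewrite /sub_path /=; case: cid => h /= ->. Qed.

Lemma path_class_sub_cat g r s t :
  path_class al (sub_path g r t) =
  (path_class al (sub_path g r s) * path_class al (sub_path g s t))%g.
Proof.
rewrite /sub_path -path_class_cat.
set h := projT1 (cid (itv_segment_path r s)).
set k := projT1 (cid (itv_segment_path s t)).
set l := projT1 (cid (itv_segment_path r t)).
rewrite -(path_class_ext al (comp_path_cat g h k)).
apply: path_class_homotopic; apply: comp_path_homotopic.
apply: (path_homotopic_equiconnecting (itv_segment_equiconnecting R) (h := id)
  (u := l) (v := path_cat h k)) => //.
- by move=> ?; exact: cvg_id.
- exact: cts_fun.
- exact: cts_fun.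
- by rewrite [LHS](path_zero (s := l)) [RHS](path_zero (s := path_cat h k)).
- by rewrite [LHS](path_one (s := l)) [RHS](path_one (s := path_cat h k)).
Qed.

End SubPaths.

Section FinitelyGeneratedPi1.
Variable R : realType.
Local Notation I := (unit_interval R).

Lemma path_connected_based (X : topologicalType) (x : X) :
  path_connected R X ->
  exists al : forall z : X, {path I from x to z in X}, al x = path_cst R x.
Proof.
move=> pcX; pose h z := projT1 (cid (pcX x z)).
exists (fun z => match pselect (x = z) with
  | left e => eq_rect x (fun z => {path I from x to z in X}) (path_cst R x) z e
  | right _ => h z end).
by case: pselect => [e|//]; rewrite (Prop_irrelevance e erefl).
Qed.

(** Shrinking to a set whose closure stays in the simple one makes the overlaps in
    [pi1_fin_generated] compact. *)
Lemma regular_simple_nbhd (X : topologicalType) (z : X) :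
  hausdorff_space X -> compact [set: X] -> simple_basis R X ->
  exists UV : set X * set X,
    [/\ simple_open R UV.1, open UV.2, UV.2 z & closure UV.2 `<=` UV.1].
Proof.
move=> hX cX sX; have [U [sU Uz _]] := sX z setT openT Logic.I.
have nU : nbhs z U by have [oU _ _] := sU; exact: open_nbhs_nbhs.
have [B nB BU] := compact_regular hX cX (@filterT _ (nbhs z) _) nU.
exists (U, B^°); split=> //; first exact: open_interior.
exact: subset_trans (closureS (@interior_subset _ B)) BU.
Qed.

(* Let [ka (i, y)] be the class of a path from [i] to [y] inside [U i]. On the
   compact set [closure (V i) `&` closure (V j)] the locally constant function
   [y |-> ka (i, y) * (ka (j, y))^-1] has finitely many values. Along a path
   [g], the class of [g] up to time [t], times [(ka (i, g t))^-1], stays in the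
   subgroup that they generate, by connectedness of the interval. *)
Lemma pi1_fin_generated (X : topologicalType) (x : X) :
  hausdorff_space X -> compact [set: X] -> simple_basis R X ->
  path_connected R X -> fin_generated [set: pi1 R x].
Proof.
move=> hX cX sX pcX; have [al alx] := path_connected_based x pcX.
have [UV UVP] := choice (fun z => regular_simple_nbhd z hX cX sX).
pose U z := (UV z).1; pose V z := (UV z).2.
have sU z : simple_open R (U z) by have [] := UVP z.
have oV z : open (V z) by have [] := UVP z.
have VU z : closure (V z) `<=` U z by have [] := UVP z.
have Vz z : V z z by have [] := UVP z.
have Uz z : U z z by apply/VU/subset_closure/Vz.
have [||D _ Dcov] := compact_cover_compact cX (D := [set: X]) (f := V).
- by move=> z _; exact: oV.
- by move=> z _; exists z.
pose K := path_class al.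
have /choice[ka kaE] (zy : X * X) : exists k, U zy.1 zy.2 ->
    forall g : {path I from zy.1 to zy.2 in X}, (forall t, U zy.1 (g t)) ->
    K _ _ g = k.
  (* Simplicity of [U] makes the class independent of the path; outside [U] the value [1] is a mere
     default. *)
  have [Uzy|] := pselect (U zy.1 zy.2); last by exists 1%g.
  have [_ pU hU] := sU zy.1; have [g Ug] := pU _ _ (Uz _) Uzy.
  exists (K _ _ g) => _ h Uh.
  by apply: path_class_homotopic; exact: hU.
have KE z a b (g : {path I from a to b in X}) : (forall t, U z (g t)) ->
    K _ _ g = ((ka (z, a))^-1 * ka (z, b))%g.
  move=> Ug; have Ua : U z a by rewrite -(path_zero (s := g)).
  have Ub : U z b by rewrite -(path_one (s := g)).
  have [_ pU _] := sU z; have [h Uh] := pU _ _ (Uz z) Ua.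
  rewrite -(kaE (z, a) Ua h Uh) -(kaE (z, b) Ub (path_cat h g)).
    by rewrite /K path_class_cat mulKg.
  by move=> t; rewrite path_catE; case: ifP.
pose F i j y := (ka (i, y) * (ka (j, y))^-1)%g.
pose C i j := closure (V i) `&` closure (V j).
(* The values of [F] serve to change the index along a loop; the classes [ka (i, x)] account for its
   two ends. *)
pose S : set (pi1 R x) :=
  (\bigcup_(i in [set` D]) \bigcup_(j in [set` D]) (F i j @` C i j)) `|`
  ((fun i => ka (i, x)) @` [set` D]).
have finS : finite_set S.
  rewrite /S finite_setU; split; last exact: finite_image.
  apply: bigcup_finite => // i _; apply: bigcup_finite => // j _.
  apply: compact_finite_image.
    apply: subclosed_compact cX _ => //.
    by apply: closedI; exact: closed_closure.
  move=> z [/VU Uiz /VU Ujz].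
  have [oUi _ _] := sU i; have [oUj _ _] := sU j.
  have [W [[oW pW _] Wz WU]] := sX z _ (openI oUi oUj) (conj Uiz Ujz).
  have : nbhs z W by exact: open_nbhs_nbhs.
  apply: filterS => y Wy _; have [g Wg] := pW _ _ Wz Wy.
  have Ei := KE i _ _ g (fun t => (WU _ (Wg t)).1).
  have Ej := KE j _ _ g (fun t => (WU _ (Wg t)).2).
  have -> : F i j y = (ka (i, z) * K _ _ g * (ka (j, z) * K _ _ g)^-1)%g.
    by rewrite {1}Ei Ej !mulVKg.
  by rewrite invgM mulgA mulgK.
exists S => //; apply/esym/seteqP; split=> // a _.
have sG := generated_subgroup S.
rewrite -[a]reprK; move: (repr a) => {a} g.
pose w t := K _ _ (sub_path g zero t).
pose P t := forall i, i \in D -> closure (V i) (g t) ->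
  generated S (w t * (ka (i, g t))^-1)%g.
have change k i j y : i \in D -> j \in D -> closure (V i) y ->
  closure (V j) y ->
    generated S (k * (ka (i, y))^-1)%g -> generated S (k * (ka (j, y))^-1)%g.
  move=> Di Dj Vi Vj Gi.
  have : generated S (F i j y).
    by apply: sub_generated; left; exists i => //; exists j => //; exists y.
  by move/(subgroupM sG Gi); rewrite /F mulgA mulgVK.
(* For [t] near [t0], [g] maps the segment between them into one [V i], where
   [w t * (ka (i, g t))^-1] does not change; [change] transfers this to the other indices. *)
have locP t0 : nbhs t0 [set t | P t <-> P t0].
  have [i Di Vit0] := Dcov (g t0) Logic.I.
  have oW : open (g @^-1` V i).
    by move/(continuousP _).1: (@cts_fun _ _ g); exact.
  have [Q oQ QE] := oW.
  have /nbhs_ballP[e /= e0 eQ] : nbhs (ival t0) Q.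
    apply: open_nbhs_nbhs; split=> //.
    have : (g @^-1` V i) t0 by [].
    by rewrite -QE.
  have near_t0 : nbhs t0 [set t : I | `|ival t0 - ival t| < e].
    have c : continuous (fun t : I => `|ival t0 - ival t|).
      apply: (comp_cts _ (@norm_continuous R R)).
      by apply: sub_cts; [exact: cst_cts|exact: ival_continuous].
    have lt0 : `|ival t0 - ival t0| < e by rewrite subrr normr0.
    exact: (c t0 _ (lt_nbhsl lt0)).
  have Vseg t r : `|ival t0 - ival t| < e -> V i (g (itv_segment ((t0, t), r))).
    move=> lte; have : (set_val @^-1` Q) (itv_segment ((t0, t), r)).
      apply: eQ.
      suff : `|ival t0 - ival (itv_segment ((t0, t), r))| < e by [].
      have /andP[a0 a1] := ival_itv t0; have /andP[b0 b1] := ival_itv t.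
      have /andP[r0 r1] := ival_itv r.
      rewrite /itv_segment clampK /=; last by apply/andP; split; nra.
      by apply: lt_norm_convex; rewrite ?subrr ?normr0 ?ival_itv.
    by rewrite [X in X _]QE.
  apply: filterS near_t0 => t /= lte.
  have Vit : V i (g t).
    have := Vseg t one lte; rewrite (_ : itv_segment _ = t) //.
    by have [_ _ K1 _] := itv_segment_equiconnecting R; exact: K1.
  have E : (w t * (ka (i, g t))^-1 = w t0 * (ka (i, g t0))^-1)%g.
    rewrite /w /K (path_class_sub_cat al g zero t0 t) -/K.
    rewrite (KE i _ _ (sub_path g t0 t)) ?mulgA ?mulgK // => r.
    by rewrite sub_pathE; apply/VU/subset_closure/Vseg.
  split=> Pt j Dj Vj.
    by apply: (change _ i j) => //; [exact: subset_closure|rewrite -E; apply: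
      Pt => //; exact: subset_closure].
  by apply: (change _ i j) => //; [exact: subset_closure|rewrite E; apply:
    Pt => //; exact: subset_closure].
have w0 : w zero = 1%g.
  by apply: (mulgI (w zero)); rewrite mulg1 /w /K -path_class_sub_cat.
have P0 : P zero.
  move=> i Di; rewrite w0 mul1g path_zero => _; apply: (subgroupV sG).
  by apply: sub_generated; right; exists i.
have [i Di Vix] := Dcov x Logic.I.
have := connected_locally_constant (@itv_connected R) locP P0 one i Di.
rewrite path_one => /(_ (subset_closure Vix)) Gw.
have Gk : generated S (ka (i, x)) by apply: sub_generated; right; exists i.
have := subgroupM sG Gw Gk; rewrite mulgVK.
congr (generated S _); rewrite -(path_class_loop g alx).
apply: path_class_ext => r; rewrite sub_pathE; congr (g _).
by rewrite /itv_segment /= ival0 ival1 mulr0 add0r mulr1 ivalK.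
Qed.

End FinitelyGeneratedPi1.

(** * Homology cobordisms *)

Section Cobordisms.
Variables (R : realType) (p : nat).
Local Notation I := (unit_interval R).

(** The 0-cochain [c0], equal to [0] on the path component of [f x] and to [1] elsewhere, vanishes
    on boundaries and on chains coming from [X]; by surjectivity on [H_0] it vanishes on every
    point. This gives connectedness of the cobordism. *)
Lemma homology0_path_connected (X Y : topologicalType) (f : continuousType X Y)
    (x : X) :
  (forall h, exists h', @homology_map R p 0 X Y f h' = h) ->
  path_connected R X -> path_connected R Y.
Proof.
move=> sur pcX; suff pf z : exists g : {path I from f x to z in Y}, True.
  move=> a b; have [g _] := pf a; have [h _] := pf b.
  by exists (path_cat (path_inv g) h).
apply: contrapT => nz.
pose s : continuousType (@std_simplex R 0) Y := cst z.
have sc : chain_of p s \in @cycle R p 0 Y by [].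
pose ss : cycles R p 0 Y := Sub (chain_of p s) sc.
have [h'] := sur (\pi_{ideal_quot (@bounding R p 0 Y)}%qT ss).
rewrite -[h']reprK homology_map_pi => /esym/eqP.
rewrite -Quotient.idealrBE => /asboolP[w]; rewrite raddfB /= => wE.
pose g0 (t : continuousType (@std_simplex R 0) Y) : 'F_p :=
  (`[< exists g : {path I from f x to t (simplex0_point R) in Y}, True >])%:R.
pose c0 (t : continuousType (@std_simplex R 0) Y) := 1 - g0 t.
have c0w : cochain_eval c0 (boundary w) = 0.
  move: w {wE}; apply: (@chain_ext0 _ _ _ _ _ (cochain_eval c0 \o @boundary R p
    0 Y)).
  move=> e; rewrite /= boundary_edge raddfB /= !cochain_evalE /c0 /g0 /=.
  have [-> ->] := face0_ends (simplex0_point R).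
  rewrite (_ : `[< _ >] = `[< exists g : {path I from f x to src e in Y}, True
    >]).
    by rewrite subrr.
  apply/asboolP/asboolP => -[g _].
    by exists (path_cat g (path_inv (path_of e))).
  by exists (path_cat g (path_of e)).
have c0f c : cochain_eval c0 (chain_map f c) = 0.
  move: c; apply: (@chain_ext0 _ _ _ _ _ (cochain_eval c0 \o @chain_map R p 0 X
    Y f)).
  move=> t; rewrite /= chain_map_of cochain_evalE /c0 /g0 asboolT ?subrr //.
  by have [g _] := pcX x (t (simplex0_point R)); exists (f \o g).
have := congr1 (cochain_eval c0) wE.
rewrite c0w raddfB /= c0f cochain_evalE /c0 /g0 asboolF // !subr0.
by move/esym/eqP; rewrite oner_eq0.
Qed.

Lemma homology_isomorphism_derived_quotients (X Y : topologicalType)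
    (f : continuousType X Y) (x : X) (y : Y) n :
  prime p -> path_connected R X -> path_connected R Y ->
  fin_generated [set: pi1 R x] -> fin_generated [set: pi1 R y] ->
  bijective (@homology_map R p 1 X Y f) ->
  (forall h, exists h', @homology_map R p 2 X Y f h' = h) ->
  isomorphic_groups
    (quotient_group (derived_pseries p (pi1 R x) n))
    (quotient_group (derived_pseries p (pi1 R y) n)).
Proof.
move=> pp pcX pcY fgX fgY [f' fK f'K] H2surj.
have [alX alXx] := path_connected_based x pcX.
have [alY alYy] := path_connected_based y pcY.
have [Phi PhiE] := cocycle_pi1 (pullback_cocycle f (edge_class_cocycle alY)) x.
have H1surj h : exists h', @homology_map R p 1 X Y f h' = h by exists (f' h).
have H1inj := can_inj fK.
apply: (isomorphic_derived_quotients (F := Phi)).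
- exact: pnil_derived_quotient.
- exact: pnil_derived_quotient.
- by move=> K pK; exact: (pnil_hom_extension H1inj H2surj alXx alYy PhiE pK).
- by move=> K pK; exact: (pnil_hom_uniqueness H1surj alX alYy PhiE pK).
Qed.

End Cobordisms.

Theorem corollary4p6 (R : realType) (p : nat) (hp : prime p)
  (m : nat) (M N : topologicalType)
  (manM : manifold R m M) (cptM : compact [set: M])
  (conM : connected [set: M])
  (manN : manifold R m N) (cptN : compact [set: N])
  (conN : connected [set: N])
  (cob : homology_cobordant R m M N p)
  (x : M) (y : N) (n : nat) :
  isomorphic_groups
    (quotient_group (derived_pseries p (pi1 R x) n))
    (quotient_group (derived_pseries p (pi1 R y) n)).
Proof.
have [C [i [j [[[manC cptC] _ _ _ _] bi bj]]]] := cob.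
have surj k (X : topologicalType) (f : continuousType X C) :
    bijective (@homology_map R p k X C f) ->
    forall h, exists h', @homology_map R p k X C f h' = h.
  by move=> [g _ gK] h; exists (g h).
have pcM := connected_path_connected (manifold_simple_basis manM) conM.
have pcN := connected_path_connected (manifold_simple_basis manN) conN.
have pcC := homology0_path_connected x (surj _ _ _ (bi 0%N)) pcM.
have fg m' (X : topologicalType) (z : X) : manifold R m' X ->
    compact [set: X] -> path_connected R X -> fin_generated [set: pi1 R z].
  move=> manX cptX; have [hX _ _] := manX.
  exact: pi1_fin_generated hX cptX (manifold_simple_basis manX).
(* Both ends are compared with [C] at the single base point [i x], although [N] reaches [C] at
   [j y]; the comparison accepts unrelated base points. *)
have iso (X : topologicalType) (f : continuousType X C) (z : X) :
    path_connected R X -> fin_generated [set: pi1 R z] ->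
    (forall k, bijective (@homology_map R p k X C f)) ->
    isomorphic_groups
      (quotient_group (derived_pseries p (pi1 R z) n))
      (quotient_group (derived_pseries p (pi1 R (i x)) n)).
  move=> pcX fgX bf; apply: (homology_isomorphism_derived_quotients (f :=
    f)) => //.
    exact: fg manC cptC pcC.
  exact: surj.
apply: isomorphic_groups_trans (iso _ i x pcM (fg _ _ _ manM cptM pcM) bi) _.
exact/isomorphic_groups_sym/(iso _ j y pcN (fg _ _ _ manN cptN pcN) bj).
Qed.
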